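(* One has \[ \lim_{n\to\infty}\frac{P_n(z)\left(\log\frac{1+z}{z}\right)^{n+1}}{n!}=\frac{1}{1+z} \] uniformly on compact subsets of $\overline{\mathbb{C}}\setminus[-1,0]$.
   Context: The Geometric polynomials $(P_n(z))_{n\ge0}$ are defined by the exponential generating function \[ \frac{1}{1-z(e^t-1)}=\sum_{n=0}^\infty P_n(z)\frac{t^n}{n!}. \] Here $\log$ is the principal branch of the logarithm and $\overline{\mathbb{C}}=\mathbb{C}\cup\{\infty\}$ is the Riemann sphere. The functions involved extend analytically to $z=\infty$, and their values at $\infty$ are understood as the corresponding limits (all equal to $0$). *)

(* Defs.v *)
From HB Require Import structures.
From mathcomp Require Import all_boot all_order all_algebra.
From mathcomp Require Import all_classical all_reals all_analysis.
From mathcomp Require Import complex.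

Set Implicit Arguments.
Unset Strict Implicit.
Unset Printing Implicit Defensive.

Import Order.TTheory GRing.Theory Num.Theory.
Import numFieldNormedType.Exports.

Local Open Scope classical_set_scope.
Local Open Scope ring_scope.
Local Open Scope complex_scope.

(* The field R[i], packed as a numClosedFieldType: the norm topology is
   canonical on abstract number fields but is not found on the concrete R[i]. *)
Definition CC (R : realType) : numClosedFieldType := R[i].

Definition cexp (R : realType) (z : CC R) : CC R :=
  let: x +i* y := z in (expR x * cos y) +i* (expR x * sin y).

(* The argument in ]-pi, pi]; junk value at z = 0. *)
Definition carg (R : realType) (z : CC R) : R :=
  let: x +i* y := z in
  let a := acos (x / Num.sqrt (x ^+ 2 + y ^+ 2)) in
  if 0 <= y then a else - a.

(* The principal branch; junk value at z = 0. *)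
Definition clog (R : realType) (z : CC R) : CC R :=
  let: x +i* y := z in ln (Num.sqrt (x ^+ 2 + y ^+ 2)) +i* carg z.

(* [Some z] is the finite point z and [None] is the point at infinity. *)
Definition riemann_sphere (R : realType) : topologicalType :=
  one_point_compactification (CC R).

Definition finite_pt (R : realType) (z : CC R) : riemann_sphere R := Some z.
Definition infinity_pt (R : realType) : riemann_sphere R := None.

(* The real segment [-1, 0] seen in the sphere. *)
Definition real_slit (R : realType) : set (riemann_sphere R) :=
  [set finite_pt (x%:C : CC R) | x in `[(-1 : R), 0]].
Arguments real_slit : clear implicits.

(* f extended to infinity by its limit there.  The limit runs over punctured
   neighbourhoods of infinity, so the default value 0 of oapp is never used. *)
Definition sphere_ext (R : realType) (f : CC R -> CC R)
    (p : riemann_sphere R) : CC R :=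
  if p is Some z then f z else lim (oapp f 0 @ (infinity_pt R)^').

Definition is_geometric_polynomials (R : realType) (P : nat -> {poly CC R}) :=
  forall z : CC R, \forall t \near (0 : CC R),
    series (fun n => (P n).[z] * t ^+ n / n`!%:R) @ \oo
      --> (1 - z * (cexp t - 1))^-1.

(* Main.v *)
Require Import Defs.
From HB Require Import structures.
From mathcomp Require Import all_boot all_order all_algebra.
From mathcomp Require Import all_classical all_reals all_analysis.
From mathcomp Require Import complex ring lra zify.

Set Implicit Arguments.
Unset Strict Implicit.
Unset Printing Implicit Defensive.

Import Order.TTheory GRing.Theory Num.Theory.
Import numFieldNormedType.Exports.

Local Open Scope classical_set_scope.
Local Open Scope ring_scope.

(** Put e^w = (1+z)/z and x = e^{-w}.  Then (1+z) P_n(z)/n! is the coefficient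
    c_n(x) of t^n in 1/(1 - x e^t), and the claim becomes
    G_n(w) := w^{n+1} c_n(e^{-w}) --> 1, uniformly for bounded w in a strip
    |Im w| <= pi - d.  Instead of the poles w + 2 pi i k and Cauchy estimates we
    use the trisection formula: summing 1/(1 - om^k y e^{t/3}) over the cube
    roots of unity gives 3/(1 - y^3 e^t), hence
      G_n(w) = G_n(w/3) + sum_{+,-} (w/(w +- 2 pi i))^{n+1} G_n((w +- 2 pi i)/3).
    Inside the strip the two ratios are at most some r < 1, and iterating
    w -> w/3 until w is near 0, where G_n tends to 1, bounds |G_n - 1| by a
    multiple of r^n sup |G_n|; the same formula on the closed strip
    |Im w| <= pi shows that this supremum is at most 4 for large n. *)

(** * Asymptotic expansions at 0+ *)

(** Letting t tend to 0 through positive reals is enough: there [cexp] is [expR], an asymptotic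
    expansion is unique, and sums, products and dilations of expansions are elementary. Identities
    between coefficients thus follow from identities between functions, without complex
    differentiation. Cube roots are chosen because of the strip: for |Im w| <= pi all three points
    w/3 and (w +- 2 pi i)/3 stay in it. The obstacle is its boundary, where one of the two ratios
    has modulus 1 and gives no decay. But for Im w >= 0 the point (w - 2 pi i)/3 that goes with this
    ratio has imaginary part in [-2 pi/3, -pi/3], where the interior estimate applies, while the
    other ratio is small; Im w < 0 is symmetric. For n large this turns a bound A of |G_n| into 2 +
    A/2, whose fixed point is 4. The estimates of G_n - 1 that are iterated carry a factor |w|, so
    that the errors met along w, w/3, w/9, ... have a geometric sum. *)

(* Over the complex numbers, [0 < t <= t0] forces t to be real. *)
Definition expands (K : numFieldType) (F : K -> K) (a : nat -> K) :=
  forall N, exists C t0 : K, [/\ 0 <= C, 0 < t0 & forall t, 0 < t <= t0 ->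
    `|F t - \sum_(i < N) a i * t ^+ i| <= C * t ^+ N].

(** The order of [K] is only partial, but positive elements are real, hence comparable. This serves
    as the minimum of two radii. *)
Lemma pos_lower_bound (K : numFieldType) (a b : K) : 0 < a -> 0 < b ->
  exists c : K, [/\ 0 < c, c <= a & c <= b].
Proof.
move=> a0 b0; have [ab|/ltW ba] := real_leP (gtr0_real a0) (gtr0_real b0).
  by exists a.
by exists b.
Qed.

Lemma expands_cst1 (K : numFieldType) :
  expands (fun _ : K => 1) (fun n => (n == 0%N)%:R).
Proof.
case=> [|N]; exists 1, 1; split=> // t t01.
  by rewrite big_ord0 subr0 normr1 expr0 mul1r.
rewrite big_ord_recl/= expr0 mulr1 big1 ?addr0 ?subrr ?normr0; last first.
  by move=> i _; rewrite mul0r.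
by rewrite mul1r exprn_ge0//; case/andP: t01 => /ltW.
Qed.

Lemma expandsD (K : numFieldType) (F G : K -> K) a b :
  expands F a -> expands G b ->
  expands (fun t => F t + G t) (fun n => a n + b n).
Proof.
move=> Fa Gb N; have [C [t0 [C0 t00 FC]]] := Fa N.
have [D [t1 [D0 t10 GD]]] := Gb N.
have [t2 [t20 t2t0 t2t1]] := pos_lower_bound t00 t10.
exists (C + D), t2; split=> [||t /andP[tp tt]]; rewrite ?addr_ge0//.
rewrite (eq_bigr (fun i : 'I_N => a i * t ^+ i + b i * t ^+ i)); last first.
  by move=> i _; rewrite mulrDl.
rewrite big_split/= opprD addrACA mulrDl (le_trans (ler_normD _ _))// lerD//.
  by rewrite FC// tp (le_trans tt).
by rewrite GD// tp (le_trans tt).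
Qed.

Lemma expandsZ (K : numFieldType) (F : K -> K) a c :
  expands F a -> expands (fun t => c * F t) (fun n => c * a n).
Proof.
move=> Fa N; have [C [t0 [C0 t00 FC]]] := Fa N.
exists (`|c| * C), t0; split=> [||t tt]//; first by rewrite mulr_ge0.
under eq_bigr do rewrite -mulrA.
by rewrite -mulr_sumr -mulrBr normrM -mulrA ler_wpM2l// FC.
Qed.

Lemma expands_dilate (K : numFieldType) (F : K -> K) a c : 0 < c ->
  expands F a -> expands (fun t => F (c * t)) (fun n => c ^+ n * a n).
Proof.
move=> c0 Fa N; have [C [t0 [C0 t00 FC]]] := Fa N.
exists (C * c ^+ N), (t0 / c); split=> [||t /andP[tp tt]].
- by rewrite mulr_ge0// exprn_ge0// ltW.
- by rewrite divr_gt0.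
rewrite -mulrA -exprMn (eq_bigr (fun i : 'I_N => a i * (c * t) ^+ i)).
  by apply: FC; rewrite mulr_gt0//= mulrC -ler_pdivlMr.
by move=> i _; rewrite exprMn mulrCA !mulrA.
Qed.

Lemma eq_expands (K : numFieldType) (F G : K -> K) (t0 : K) a b : 0 < t0 ->
  (forall t, 0 < t <= t0 -> F t = G t) -> a =1 b -> expands F a -> expands G b.
Proof.
move=> t00 FG ab Fa N; have [C [t1 [C0 t10 FC]]] := Fa N.
have [t2 [t20 t2t0 t2t1]] := pos_lower_bound t00 t10.
exists C, t2; split=> // t /andP[tp tt].
under eq_bigr do rewrite -ab.
by rewrite -FG ?FC ?tp//= (le_trans tt).
Qed.

Lemma le0_of_small (K : numFieldType) (x C t0 : K) : 0 <= x -> 0 <= C -> 0 < t0 ->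
  (forall t, 0 < t <= t0 -> x <= C * t) -> x = 0.
Proof.
move=> x0 C0 t00 xC; apply/eqP; rewrite eq_le x0 andbT.
have xr := ger0_real x0.
rewrite real_leNgt// ?real0//; apply/negP => xp.
have C1 : 0 < C + 1 by rewrite ltr_wpDl.
have [t [tp tt0 tx]] := pos_lower_bound t00 (divr_gt0 (divr_gt0 xp (ltr0n _ 2)) C1).
have := xC t; rewrite tp tt0 => /(_ isT) h.
have : C * t < x.
  apply: (@le_lt_trans _ _ ((C + 1) * t)); first by rewrite ler_wpM2r ?lerDl// ltW.
  apply: (@le_lt_trans _ _ (x / 2)); last by rewrite ltr_pdivrMr// mulr_natr mulr2n ltrDl.
  by rewrite mulrC -ler_pdivlMr.
by move=> /(le_lt_trans h); rewrite ltxx.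
Qed.

(** Strong induction: once the coefficients below n agree, the difference of the two expansions at
    order n+1 gives |a n - b n| t^n <= C t^(n+1), and t can be taken arbitrarily small. *)
Lemma expands_inj (K : numFieldType) (F : K -> K) a b :
  expands F a -> expands F b -> a =1 b.
Proof.
move=> Fa Fb; have Fd := expandsD Fa (expandsZ (-1) Fb).
elim/ltn_ind => n IHn; apply/eqP; rewrite -subr_eq0 -normr_eq0; apply/eqP.
have [C [t0 [C0 t00 FC]]] := Fd n.+1.
apply: (le0_of_small _ C0 t00) => // t tt; have := FC t tt.
have tp : 0 < t by case/andP: tt.
rewrite mulN1r subrr sub0r normrN big_ord_recr/= big1 ?add0r; last first.
  by move=> i _; rewrite IHn// mulN1r subrr mul0r.
by rewrite mulN1r normrM normrX (ger0_norm (ltW tp)) exprS mulrA ler_pM2r// exprn_gt0.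
Qed.

Lemma horner_bounded (K : numFieldType) (p : {poly K}) :
  exists2 C : K, 0 <= C & forall t, 0 < t <= 1 -> `|p.[t]| <= C.
Proof.
exists (\sum_(i < size p) `|p`_i|); first exact: sumr_ge0.
move=> t /andP[tp t1]; rewrite horner_coef (le_trans (ler_norm_sum _ _ _))//.
apply: ler_sum => i _; rewrite normrM ler_piMr// normrX (ger0_norm (ltW tp)).
by rewrite exprn_ile1// ltW.
Qed.

Lemma expandsM (K : numFieldType) (F G : K -> K) a b :
  expands F a -> expands G b ->
  expands (fun t => F t * G t) (fun n => \sum_(j < n.+1) a j * b (n - j)%N).
Proof.
move=> Fa Gb N; have [C [t0 [C0 t00 FC]]] := Fa N.
have [D [t1 [D0 t10 GD]]] := Gb N.
have [t2 [t20 t2t0 t2t1]] := pos_lower_bound t00 t10.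
have [t3 [t30 t3t2 t31]] := pos_lower_bound t20 (ltr01 : 0 < 1 :> K).
pose p := \poly_(i < N) a i; pose q := \poly_(i < N) b i.
(* The part of [p * q] of degree below N has the Cauchy product coefficients; the rest is [r] times
   t^N, and [r] is bounded on ]0, 1], hence the radius [t3] <= 1. *)
pose r := drop_poly N (p * q).
have [Cp Cp0 pC] := horner_bounded p.
have [Cq Cq0 qC] := horner_bounded q.
have [Cr Cr0 rC] := horner_bounded r.
exists (C * (Cq + D) + Cp * D + Cr), t3.
split=> [||t /andP[tp tt]] //; first by rewrite !addr_ge0 ?mulr_ge0 ?addr_ge0.
have tp1 : 0 < t <= 1 by rewrite tp (le_trans tt).
have tN0 : 0 <= t ^+ N by rewrite exprn_ge0// ltW.
have tN1 : t ^+ N <= 1 by case/andP: tp1 => ? ?; rewrite exprn_ile1 ?(ltW tp).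
have Fp : `|F t - p.[t]| <= C * t ^+ N.
  by rewrite horner_poly FC// tp (le_trans tt)// (le_trans t3t2).
have Gq : `|G t - q.[t]| <= D * t ^+ N.
  by rewrite horner_poly GD// tp (le_trans tt)// (le_trans t3t2).
have -> : \sum_(i < N) (\sum_(j < i.+1) a j * b (i - j)%N) * t ^+ i =
    p.[t] * q.[t] - r.[t] * t ^+ N.
  have := poly_take_drop N (p * q) => /(congr1 (horner^~ t)).
  rewrite /= hornerD !hornerM hornerXn => <-; rewrite addrK.
  rewrite /take_poly horner_poly; apply: eq_bigr => i _; congr (_ * _).
  rewrite coefM; apply: eq_bigr => j _; rewrite !coef_poly.
  have jN : (j < N)%N by rewrite (leq_ltn_trans _ (ltn_ord i))// -ltnS.
  by rewrite jN (leq_ltn_trans (leq_subr _ _)).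
have -> : F t * G t - (p.[t] * q.[t] - r.[t] * t ^+ N) =
  (F t - p.[t]) * (q.[t] + (G t - q.[t])) + p.[t] * (G t - q.[t]) + r.[t] * t ^+ N.
  by ring.
rewrite (le_trans (ler_normD _ _))// [leRHS]mulrDl lerD//; last first.
  by rewrite normrM (ger0_norm tN0) ler_wpM2r ?rC.
rewrite (le_trans (ler_normD _ _))// [leRHS]mulrDl lerD// normrM; last first.
  by rewrite -mulrA ler_pM ?pC.
rewrite [leRHS]mulrAC ler_pM// (le_trans (ler_normD _ _))// lerD ?qC//.
by rewrite (le_trans Gq)// ler_piMr.
Qed.

(** Convergence at [t0] bounds the terms there by some B, so for t <= t0/2 the tail from N on is
    dominated by a geometric series of ratio 1/2 and first term B (t/t0)^N. *)
Lemma power_series_expands (K : numFieldType) (F : K -> K) (a : nat -> K) (t0 : K) :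
  0 < t0 -> (forall t, 0 < t <= t0 ->
    series (fun n => a n * t ^+ n) @ \oo --> F t) -> expands F a.
Proof.
move=> t00 Fa N.
have [B B0 aB] : exists2 B : K, 0 < B & forall n, `|a n * t0 ^+ n| <= B.
  have : cvgn (fun n => a n * t0 ^+ n).
    apply: cvgP; apply: cvg_series_cvg_0; apply: cvgP; apply: Fa.
    by rewrite t00 lexx.
  move=> /cvg_seq_bounded/pinfty_ex_gt0[B B0 aB]; exists B => // n.
  exact: aB.
exists (B / t0 ^+ N * 2), (t0 / 2); split=> [||t /andP[tp tt]].
- by rewrite mulr_ge0// divr_ge0 ?exprn_ge0// ltW.
- by rewrite divr_gt0.
have u0 : 0 <= t / t0 by rewrite divr_ge0// ltW.
have u2 : t / t0 <= 2^-1 by rewrite ler_pdivrMr// mulrC.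
have t0n0 : t0 != 0 by rewrite gt_eqF.
have aE n : `|a n * t ^+ n| <= B * (t / t0) ^+ n.
  have -> : a n * t ^+ n = a n * t0 ^+ n * (t / t0) ^+ n.
    by rewrite expr_div_n; field; rewrite expf_neq0.
  by rewrite normrM (ger0_norm (exprn_ge0 _ u0)) ler_wpM2r// exprn_ge0.
(* The factor 2 - 2 * 2^-k is the sum of 2^-i over i < k. *)
have tail k : `|\sum_(i < N + k) a i * t ^+ i - \sum_(i < N) a i * t ^+ i|
    <= B * (t / t0) ^+ N * (2 - 2 * 2^-1 ^+ k).
  elim: k => [|k IHk]; first by rewrite addn0 subrr normr0 expr0 mulr1 subrr mulr0.
  rewrite addnS big_ord_recr/= addrAC (le_trans (ler_normD _ _))//.
  rewrite (@le_trans _ _ (B * (t / t0) ^+ N * (2 - 2 * 2^-1 ^+ k) +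
    B * (t / t0) ^+ N * 2^-1 ^+ k))//.
    rewrite lerD// (le_trans (aE _))// exprD mulrA ler_wpM2l//.
      by rewrite mulr_ge0 ?exprn_ge0// ltW.
    by rewrite lerXn2r// nnegrE.
  by rewrite -mulrDr exprS le_eqVlt; apply/orP; left; apply/eqP; field.
apply/ler_addgt0Pr => e e0.
have tt0 : 0 < t <= t0.
  by rewrite tp (le_trans tt)// ler_pdivrMr// ler_peMr ?ler1n// ltW.
have /cvgrPdist_le/(_ _ e0) := Fa t tt0; rewrite seriesEord => -[m _ mP].
have := mP (N + m)%N (leq_addl _ _) => /= hm.
rewrite -(subrK (\sum_(i < N + m) a i * t ^+ i) (F t)) -addrA.
rewrite (le_trans (ler_normD _ _))// [leRHS]addrC lerD// (le_trans (tail m))//.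
have -> : B / t0 ^+ N * 2 * t ^+ N = B * (t / t0) ^+ N * 2.
  by rewrite expr_div_n; field; rewrite expf_neq0.
rewrite ler_wpM2l ?mulr_ge0 ?exprn_ge0 ?(ltW B0)// gerBl mulr_ge0// exprn_ge0//.
Qed.

Lemma expR_expands (R : realType) : expands (@expR R) (fun n => n`!%:R^-1).
Proof.
apply: (@power_series_expands _ _ _ 1) => // t _.
rewrite -exp_coeffE. exact: is_cvg_series_exp_coeff.
Qed.

Lemma ltc0P (R : realType) (t : CC R) : 0 < t -> exists2 x : R, 0 < x & t = x%:C%C.
Proof.
by case: t => x y; rewrite ltcE/= => /andP[/eqP -> x0]; exists x.
Qed.

Lemma cexp_real (R : realType) (x : R) : cexp (x%:C%C : CC R) = (expR x)%:C%C.
Proof. by rewrite /cexp/= cos0 sin0 mulr1 mulr0. Qed.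

Lemma cexp_expands (R : realType) :
  expands (@cexp R) (fun n => n`!%:R^-1).
Proof.
move=> N; have [C [t0 [C0 t00 FC]]] := @expR_expands R N.
exists (C%:C%C), (t0%:C%C); split=> [||t /andP[/ltc0P[x x0 ->]]].
- by rewrite lecR.
- by rewrite ltcR.
rewrite lecR cexp_real => xt.
have -> : \sum_(i < N) (i`!%:R : CC R)^-1 * (x%:C%C : CC R) ^+ i =
   (\sum_(i < N) i`!%:R^-1 * x ^+ i)%:C%C.
  rewrite rmorph_sum; apply: eq_bigr => i _.
  by rewrite rmorphM fmorphV rmorph_nat rmorphXn.
rewrite -rmorphB -rmorphXn -rmorphM normc_def/= expr0n/= addr0 sqrtr_sqr lecR.
by apply: FC; rewrite x0.
Qed.

(** * Coefficients of 1 / (1 - x e^t) *)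

Lemma cexpD (R : realType) (z w : CC R) : cexp (z + w) = cexp z * cexp w.
Proof.
case: z => a b; case: w => c d; rewrite /cexp/= expRD cosD sinD.
by apply/eqP; rewrite eq_complex/=; apply/andP; split; apply/eqP; ring.
Qed.

Lemma cexp0 (R : realType) : cexp (0 : CC R) = 1.
Proof. by rewrite (cexp_real 0) expR0. Qed.

Lemma cexp_neq0 (R : realType) (z : CC R) : cexp z != 0.
Proof.
apply/eqP => z0; have := cexpD z (- z).
by rewrite subrr cexp0 z0 mul0r => /eqP; rewrite oner_eq0.
Qed.

Lemma cexpN (R : realType) (z : CC R) : cexp (- z) = (cexp z)^-1.
Proof.
apply: (mulfI (cexp_neq0 z)).
by rewrite -cexpD subrr cexp0 divff// cexp_neq0.
Qed.

(** At order 1 the expansion of [cexp] reads |e^t - 1| <= C t. A zero 1 = x e^t would give |1 - x| =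
    |x| |e^t - 1| <= |x| C t, impossible for small t. *)
Lemma one_sub_cexp_neq0 (R : realType) (x : CC R) : x != 1 ->
  exists2 t0 : CC R, 0 < t0 & forall t, 0 < t <= t0 -> 1 - x * cexp t != 0.
Proof.
move=> x1; have [C [t0 [C0 t00 FC]]] := @cexp_expands R 1%N.
have x1' : 0 < `|1 - x| by rewrite normr_gt0 subr_eq0 eq_sym.
have D0 : 0 < `|x| * C + 1 by rewrite ltr_wpDl// mulr_ge0.
have [t1 [t10 t1t0 t1x]] :=
  pos_lower_bound t00 (divr_gt0 (divr_gt0 x1' (ltr0n _ 2)) D0).
exists t1 => // t /andP[tp tt]; apply/eqP => xt.
have := FC t; rewrite tp (le_trans tt)// => /(_ isT).
rewrite big_ord1 expr0 mulr1 invr1 expr1 => et.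
have : `|1 - x| <= `|x| * (C * t).
  have -> : 1 - x = x * (cexp t - 1).
    by rewrite mulrBr mulr1 -[x * cexp t](subrK 1) -opprB xt oppr0 add0r.
  by rewrite normrM ler_wpM2l.
apply/negP; rewrite -real_ltNge ?ger0_real// ?mulr_ge0 ?(ltW tp)//.
apply: (@le_lt_trans _ _ ((`|x| * C + 1) * t)).
  by rewrite mulrA ler_wpM2r ?lerDl// ltW.
apply: (@le_lt_trans _ _ (`|1 - x| / 2)); last first.
  by rewrite ltr_pdivrMr// mulr_natr mulr2n ltrDl.
by rewrite mulrC -ler_pdivlMr// (le_trans tt).
Qed.

(* The coefficient of t^n in 1 / (1 - x e^t), for x <> 1. *)
Definition geo_coef (R : realType) (P : nat -> {poly CC R}) (x : CC R) (n : nat) : CC R :=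
  (P n).[x / (1 - x)] / n`!%:R / (1 - x).

(** For z = x/(1 - x) one has 1 - z (e^t - 1) = (1 - x e^t)/(1 - x), so the generating function of
    the P_n(z) is 1/(1 - x e^t) up to the factor 1 - x. *)
Lemma geo_coef_expands (R : realType) (P : nat -> {poly CC R}) (x : CC R) :
  is_geometric_polynomials P -> x != 1 ->
  expands (fun t : CC R => (1 - x * cexp t)^-1) (geo_coef P x).
Proof.
move=> hP x1; pose z := x / (1 - x).
have x1' : 1 - x != 0 by rewrite subr_eq0 eq_sym.
have := hP z => /nbhs_ballP[e /= e0 eP].
have Fz : expands (fun t : CC R => (1 - z * (cexp t - 1))^-1)
    (fun n => (P n).[z] / n`!%:R).
  apply: (@power_series_expands _ _ _ (e / 2)); first by rewrite divr_gt0.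
  move=> t /andP[tp te]; under [fun n => _]funext do rewrite mulrAC.
  apply: eP; rewrite /ball/= sub0r normrN gtr0_norm// (le_lt_trans te)//.
  by rewrite ltr_pdivrMr// mulr_natr mulr2n ltrDl.
apply: (eq_expands ltr01 _ _ (expandsZ (1 - x)^-1 Fz)) => [t _|n].
  rewrite -invfM; congr (_^-1).
  have -> : z * (cexp t - 1) = x * (cexp t - 1) / (1 - x) by rewrite mulrAC.
  by rewrite mulrBr mulr1 mulrCA mulfV// mulr1 mulrBr; ring.
by rewrite mulrC.
Qed.

(** Compare coefficients of t^n in (1 - x e^t)^-1 (1 - x e^t) = 1 and isolate the term j = n of the
    Cauchy product. *)
Lemma geo_coef_rec (R : realType) (P : nat -> {poly CC R}) (x : CC R) n :
  is_geometric_polynomials P -> x != 1 ->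
  geo_coef P x n * (1 - x) =
  (n == 0%N)%:R + x * \sum_(j < n) geo_coef P x j / (n - j)`!%:R.
Proof.
move=> hP x1; have Fx := geo_coef_expands hP x1.
have Gx := expandsD (@expands_cst1 (CC R)) (expandsZ (- x) (@cexp_expands R)).
have [t0 t00 t0P] := one_sub_cexp_neq0 x1.
have FG1 t : 0 < t <= t0 -> (1 - x * cexp t)^-1 * (1 + - x * cexp t) = 1.
  by move=> tt; rewrite mulNr mulVf// t0P.
have E1 := eq_expands t00 FG1 (fun _ => erefl) (expandsM Fx Gx).
rewrite (expands_inj (@expands_cst1 (CC R)) E1 n).
rewrite big_ord_recr/= subnn eqxx invr1 mulr1.
rewrite mulr_sumr -addrA addrCA -big_split/= big1 ?addr0 // => i _.
rewrite subn_eq0 leqNgt ltn_ord add0r; ring.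
Qed.

(** Partial fractions of 3/(1 - v^3) at v = y e^(t/3). The dilation t/3 costs 3^-n on the
    coefficients, which with the numerator 3 accounts for 3^(n+1). *)
Lemma geo_coef_trisection (R : realType) (P : nat -> {poly CC R}) (om y : CC R) n :
  is_geometric_polynomials P -> 1 + om + om ^+ 2 = 0 -> y ^+ 3 != 1 ->
  3 ^+ n.+1 * geo_coef P (y ^+ 3) n =
  geo_coef P y n + geo_coef P (om * y) n + geo_coef P (om ^+ 2 * y) n.
Proof.
move=> hP om0 y3.
have om3 : om ^+ 3 = 1.
  by apply/eqP; rewrite -subr_eq0; apply/eqP; rewrite -[RHS](mulr0 (om - 1)) -om0; ring.
have neq1 k u : (om ^+ k * u) ^+ 3 = u ^+ 3.
  by rewrite exprMn -exprM mulnC exprM om3 expr1n mul1r.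
have cube_neq1 (u : CC R) : u ^+ 3 != 1 -> u != 1.
  by apply: contraNneq => ->; rewrite expr1n.
have yP k : expands (fun t : CC R => (1 - om ^+ k * y * cexp (3^-1 * t))^-1)
    (fun n => 3^-1 ^+ n * geo_coef P (om ^+ k * y) n).
  apply: (expands_dilate _ (geo_coef_expands hP _)); first by rewrite invr_gt0.
  by apply: cube_neq1; rewrite neq1.
have S := expandsD (expandsD (yP 0%N) (yP 1%N)) (yP 2%N).
have [t0 t00 t0P] := one_sub_cexp_neq0 y3.
have n3 : (3 : CC R) != 0 by rewrite pnatr_eq0.
have FG t : 0 < t <= t0 ->
    (1 - om ^+ 0 * y * cexp (3^-1 * t))^-1 + (1 - om ^+ 1 * y * cexp (3^-1 * t))^-1 +
    (1 - om ^+ 2 * y * cexp (3^-1 * t))^-1 = 3 * (1 - y ^+ 3 * cexp t)^-1.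
  move=> tt; have := t0P t tt.
  have -> : cexp t = cexp (3^-1 * t) ^+ 3.
    have {1}-> : t = 3^-1 * t + 3^-1 * t + 3^-1 * t by field.
    by rewrite !cexpD; ring.
  set u := cexp (3^-1 * t); rewrite -exprMn -!(mulrA _ y u); move: (y * u) => v v3.
  have vP k : 1 - om ^+ k * v != 0.
    rewrite subr_eq0 eq_sym; apply: cube_neq1; rewrite neq1.
    by rewrite eq_sym -subr_eq0.
  have := vP 0%N; have := vP 1%N; have := vP 2%N; rewrite expr0 expr1 !mul1r => v2 v1 v0.
  have e2 : om ^+ 2 = - 1 - om by rewrite -[LHS]subr0 -om0; ring.
  rewrite e2 in v2 *.
  have e3 : 1 - v ^+ 3 = (1 - v) * (1 - om * v) * (1 - (- 1 - om) * v).
    have -> : (1 - v) * (1 - om * v) * (1 - (- 1 - om) * v) =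
      1 - v ^+ 3 + (1 + om + om ^+ 2) * (v ^+ 3 - v ^+ 2) by ring.
    by rewrite om0 mul0r addr0.
  (* The two sides agree only modulo [om0]: a zero is added on the right and rewritten as 1 + om +
     om^2 times the cofactor that makes the equation an identity of rational functions. *)
  rewrite e3 -[RHS]addr0 -(mul0r (- v ^+ 2 / ((1 - v) * (1 - om * v) * (1 - (- 1 - om) * v)))) -om0.
  by field; rewrite v0 v1 v2.
have := expands_inj (eq_expands t00 FG (fun _ => erefl) S)
  (expandsZ 3 (geo_coef_expands hP y3)) n.
rewrite expr0 expr1 mul1r => sE; rewrite exprSr -mulrA -sE.
by rewrite -!mulrDr mulrA -exprMn divff// expr1n mul1r.
Qed.

(** * Real and complex estimates *)

Lemma sin_mvt (R : realType) (y : R) : 0 <= y ->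
  exists2 c, 0 <= c <= y & sin y = y * cos c.
Proof.
move=> y0; have [c] := @MVT_segment R sin cos 0 y y0 (fun x _ => is_derive_sin x)
  (continuous_subspaceT (@continuous_sin R)).
by rewrite in_itv/= sin0 !subr0 => cy ->; exists c => //; rewrite mulrC.
Qed.

Lemma norm_sin_le (R : realType) (y : R) : `|sin y| <= `|y|.
Proof.
wlog y0 : y / 0 <= y => [h|].
  have [/h//|/ltW y0] := leP 0 y.
  by rewrite -normrN -sinN -[leRHS]normrN h// oppr_ge0.
have [c _ ->] := sin_mvt y0.
by rewrite normrM ler_piMr// cos_max.
Qed.

Lemma one_sub_cosE (R : realType) (y : R) : 1 - cos y = 2 * sin (y / 2) ^+ 2.
Proof.
have {1}-> : y = (y / 2) *+ 2 by rewrite -mulr_natr divfK// pnatr_eq0.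
by rewrite cos_mulr2n cos2sin2; ring.
Qed.

Lemma one_sub_cos_le (R : realType) (y : R) : 1 - cos y <= y ^+ 2 / 2.
Proof.
rewrite one_sub_cosE; have := norm_sin_le (y / 2).
rewrite -ler_sqr ?nnegrE// !real_normK ?num_real// expr_div_n; lra.
Qed.

Lemma norm_sin_sub_le (R : realType) (y : R) : `|y| <= 1 -> `|sin y - y| <= y ^+ 2.
Proof.
wlog y0 : y / 0 <= y => [h y1|].
  have [/h->//|/ltW y0] := leP 0 y.
  have -> : sin y - y = - (sin (- y) - (- y)) by rewrite sinN; ring.
  by rewrite normrN -sqrrN h ?oppr_ge0 ?normrN.
have [c /andP[c0 cy] ->] := sin_mvt y0.
rewrite ger0_norm// => y1.
have := one_sub_cos_le c; have := cos_le1 c => ? ?.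
rewrite ler0_norm; nra.
Qed.

Lemma mulr_cos_le_sin (R : realType) (v : R) : 0 <= v <= pi -> v * cos v <= sin v.
Proof.
move=> /andP[v0 vpi]; have [c /andP[c0 cv] ->] := sin_mvt v0.
rewrite ler_wpM2l// leNgt ltr_cos ?in_itv/= -?leNgt// ?c0 ?v0//.
exact: le_trans cv _.
Qed.

(** With v = u/2, sin u = 2 cos v sin v >= 2 v cos^2 v = u (1 + cos u)/2, and cos u >= 0. This
    yields a quadratic lower bound of 1 - cos valid up to |y| = pi, the edge of the closed strip. *)
Lemma half_le_sin (R : realType) (u : R) : 0 <= u <= pi / 2 -> u / 2 <= sin u.
Proof.
move=> /andP[u0 upi].
have vP : 0 <= u / 2 <= pi by have := pi_ge0 R; lra.
have cu : 0 <= cos u by apply: cos_ge0_pihalf; rewrite upi andbT; lra.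
have cv : 0 <= cos (u / 2) by apply: cos_ge0_pihalf; lra.
have := mulr_cos_le_sin vP.
have -> : sin u = (cos (u / 2) * sin (u / 2)) *+ 2.
  by rewrite -sin_mulr2n -(mulr_natr (u / 2)) divfK// pnatr_eq0.
have : cos u = cos (u / 2) ^+ 2 *+ 2 - 1.
  by rewrite -cos_mulr2n -(mulr_natr (u / 2)) divfK// pnatr_eq0.
nra.
Qed.

Lemma one_sub_cos_ge (R : realType) (y : R) : `|y| <= pi -> y ^+ 2 / 8 <= 1 - cos y.
Proof.
rewrite -(cos_norm y) -(real_normK (num_real y)); move: `|y| (normr_ge0 y) => {}y y0 ypi.
rewrite one_sub_cosE; have := @half_le_sin R (y / 2); nra.
Qed.

Lemma expR_sub1_sub_ge0 (R : realType) (a : R) : 0 <= expR a - 1 - a.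
Proof. by have := expR_ge1Dx a; lra. Qed.

Lemma expR_sub1_sub_le (R : realType) (a : R) : `|a| <= 2^-1 ->
  expR a - 1 - a <= 2 * a ^+ 2.
Proof.
rewrite ler_norml => /andP[a1 a2].
have := expR_ge1Dx (- a); rewrite expRN => h.
have e0 := expR_gt0 a.
have : expR a * (1 - a) <= 1.
  by rewrite -[leRHS](mulfV (lt0r_neq0 e0)) ler_wpM2l// ltW.
nra.
Qed.

(** The norm of [CC R] takes its values in [CC R]; a modulus in [R] gives access to a total order
    and to real arithmetic. *)
Definition cmod (R : realType) (z : CC R) : R := Normc.normc z.
Arguments cmod : simpl never.

Lemma normCE (R : realType) (z : CC R) : `|z| = (cmod z)%:C%C.
Proof. by case: z. Qed.

Lemma cmodM (R : realType) (z w : CC R) : cmod (z * w) = cmod z * cmod w.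
Proof. exact: Normc.normcM. Qed.

Lemma cmodV (R : realType) (z : CC R) : cmod z^-1 = (cmod z)^-1.
Proof. exact: Normc.normcV. Qed.

Lemma cmod1 (R : realType) : cmod (1 : CC R) = 1.
Proof. exact: Normc.normc1. Qed.

Lemma cmodX (R : realType) (z : CC R) n : cmod (z ^+ n) = cmod z ^+ n.
Proof. by elim: n => [|n IHn]; rewrite ?expr0 ?cmod1// !exprS cmodM IHn. Qed.

Lemma cmodN (R : realType) (z : CC R) : cmod (- z) = cmod z.
Proof. exact: normcN. Qed.

Lemma cmodBC (R : realType) (z w : CC R) : cmod (z - w) = cmod (w - z).
Proof. by rewrite -cmodN opprB. Qed.

Lemma le_cmodD (R : realType) (z w : CC R) : cmod (z + w) <= cmod z + cmod w.
Proof. exact: le_normcD. Qed.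

Lemma cmod_ge0 (R : realType) (z : CC R) : 0 <= cmod z.
Proof. by case: z => x y; exact: sqrtr_ge0. Qed.

Lemma cmod0 (R : realType) : cmod (0 : CC R) = 0.
Proof. exact: Normc.normc0. Qed.

Lemma cmod_gt0 (R : realType) (z : CC R) : (0 < cmod z) = (z != 0).
Proof.
rewrite lt0r cmod_ge0 andbT; congr (~~ _); apply/eqP/eqP => [|->].
  exact: Normc.eq0_normc.
exact: cmod0.
Qed.

Lemma cmod_real (R : realType) (x : R) : cmod (x%:C%C : CC R) = `|x|.
Proof. by rewrite /cmod/= expr0n addr0 sqrtr_sqr. Qed.

Lemma cmod_nat (R : realType) n : cmod (n%:R : CC R) = n%:R.
Proof.
have -> : n%:R = (n%:R : R)%:C%C :> CC R by rewrite rmorph_nat.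
by rewrite cmod_real ger0_norm.
Qed.

Lemma sqr_cmod (R : realType) (z : CC R) : cmod z ^+ 2 = complex.Re z ^+ 2 + complex.Im z ^+ 2.
Proof. by case: z => x y; rewrite /cmod/= sqr_sqrtr// addr_ge0 ?sqr_ge0. Qed.

Lemma norm_Re_le (R : realType) (z : CC R) : `|complex.Re z| <= cmod z.
Proof.
by rewrite -ler_sqr ?nnegrE ?cmod_ge0// sqr_cmod real_normK ?num_real// lerDl sqr_ge0.
Qed.

Lemma norm_Im_le (R : realType) (z : CC R) : `|complex.Im z| <= cmod z.
Proof.
by rewrite -ler_sqr ?nnegrE ?cmod_ge0// sqr_cmod real_normK ?num_real// lerDr sqr_ge0.
Qed.

Lemma cmod_le_ReIm (R : realType) (z : CC R) : cmod z <= `|complex.Re z| + `|complex.Im z|.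
Proof.
rewrite -ler_sqr ?nnegrE ?cmod_ge0 ?addr_ge0// sqr_cmod sqrrD !real_normK ?num_real//.
by rewrite lerD2r lerDl mulrn_wge0// mulr_ge0.
Qed.

Lemma cmod_cexp (R : realType) (z : CC R) : cmod (cexp z) = expR (complex.Re z).
Proof.
case: z => x y; rewrite /cmod/= !exprMn -mulrDr cos2Dsin2 mulr1 sqrtr_sqr.
by rewrite ger0_norm// expR_ge0.
Qed.

(* The condition [w != 0] is included because the normalized coefficients
   below take the junk value 0 at 0, instead of their limit 1. *)
Definition box (R : realType) (M d : R) (w : CC R) : Prop :=
  [/\ w != 0, `|complex.Re w| <= M & `|complex.Im w| <= d].

(** For w = x + iy and e = e^(-x), |1 - e^(-w)|^2 = (1 - e)^2 + 2 e (1 - cos y), which separates the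
    two directions. With c = e^(-M) the first term is at least c^2 x^2 and the second at least c^2
    y^2/4, since c^2 <= c <= e; hence the constant c/2. *)
Lemma cmod_one_sub_cexpN_ge (R : realType) (M : R) (w : CC R) :
  box M pi w -> expR (- M) / 2 * cmod w <= cmod (1 - cexp (- w)).
Proof.
case: w => x y [_ /= xM ypi]; have M0 : 0 <= M := le_trans (normr_ge0 _) xM.
have c0 : 0 <= expR (- M) / 2 by rewrite mulr_ge0 ?expR_ge0.
rewrite -ler_sqr ?nnegrE ?cmod_ge0 ?mulr_ge0 ?cmod_ge0//.
rewrite exprMn !sqr_cmod/=.
rewrite cosN sinN; set c := expR (- M) in c0 *; set e := expR (- x).
have ce : c <= e by rewrite ler_expR; move: xM; rewrite ler_norml; lra.
have cpos : 0 < c by exact: expR_gt0.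
have c1 : c <= 1 by rewrite /c -expR0 ler_expR; lra.
have h1 : c ^+ 2 * x ^+ 2 <= (1 - e) ^+ 2.
  have [x0|x0] := leP 0 x.
    have := expR_ge1Dx x; have : expR x * e = 1 by rewrite /e -expRD subrr expR0.
    move=> ee ex; have cx : c * x <= 1 - e by nra.
    have cx0 : 0 <= c * x by rewrite mulr_ge0// ltW.
    by rewrite -exprMn lerXn2r// nnegrE (le_trans cx0).
  have := expR_ge1Dx (- x); rewrite -/e => ex.
  have cx : c * - x <= e - 1 by nra.
  have cx0 : 0 <= c * - x by rewrite mulr_ge0 ?(ltW cpos)// oppr_ge0 ltW.
  by rewrite -(sqrrN x) -exprMn -[leRHS]sqrrN opprB lerXn2r// nnegrE (le_trans cx0).
have := one_sub_cos_ge ypi; have := cos2Dsin2 y; have := cos_le1 y.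
move: (cos y) (sin y) => C S C1 CS h2.
have -> : (1 - e * C) ^+ 2 + (0 - e * - S) ^+ 2 = (1 - e) ^+ 2 + 2 * e * (1 - C).
  by have -> : (0 - e * - S) ^+ 2 = e ^+ 2 * S ^+ 2 by [ring]; nra.
have : c ^+ 2 * y ^+ 2 <= 8 * (e * (1 - C)).
  have y20 := sqr_ge0 y; have c2 : c ^+ 2 <= e by nra.
  have : c ^+ 2 * y ^+ 2 <= e * y ^+ 2 by rewrite ler_wpM2r.
  nra.
have : 0 <= c ^+ 2 * x ^+ 2 by rewrite mulr_ge0 ?sqr_ge0.
rewrite expr_div_n; nra.
Qed.

Lemma cmod_cexp_sub_le (R : realType) (w : CC R) :
  cmod w <= 2^-1 -> cmod (1 - cexp (- w) - w) <= 5 * cmod w ^+ 2.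
Proof.
move=> w2; have := norm_Re_le w; have := norm_Im_le w; rewrite sqr_cmod.
case: w w2 => x y w2 /= yw xw; apply: (le_trans (cmod_le_ReIm _)) => /=.
rewrite cosN sinN; move: (le_trans xw w2) (le_trans yw w2) => x2 y2 {xw yw w2}.
have xN2 : `|- x| <= 2^-1 by rewrite normrN.
have := expR_sub1_sub_le xN2; have := expR_sub1_sub_ge0 (- x).
set e := expR (- x) => e1 e2; rewrite sqrrN in e2.
have := one_sub_cos_le y; have := cos_le1 y => c1 c2.
have s1 : `|sin y - y| <= y ^+ 2 by apply: norm_sin_sub_le; rewrite (le_trans y2)//; lra.
move: (cos y) (sin y) c1 c2 s1 => C S c1 c2.
move: x2 y2; rewrite !ler_norml => /andP[xa xb] /andP[ya yb] /andP[sa sb].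
have xx : x ^+ 2 <= 4^-1.
  by have : 0 <= (2^-1 - x) * (x - - 2^-1) by [rewrite mulr_ge0 ?subr_ge0]; lra.
have e0 : 0 < e := expR_gt0 _.
have ele : e <= 2 by lra.
have re : `|1 - e * C - x| <= 2 * x ^+ 2 + y ^+ 2.
  rewrite ler_norml; apply/andP; split; nra.
have im : `|0 - e * - S - y| <= 3 * y ^+ 2 + 3 * x ^+ 2.
  have -> : 0 - e * - S - y = e * (S - y) + y * (e - 1) by ring.
  have eS : - (2 * y ^+ 2) <= e * (S - y) <= 2 * y ^+ 2 by apply/andP; split; nra.
  have ee : (e - 1) ^+ 2 <= 4 * x ^+ 2.
    have [x0|x0] := leP 0 x.
      have : 0 <= 1 - e <= x by apply/andP; split; nra.
      move=> /andP[? ?]; nra.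
    have : 0 <= e - 1 <= - 2 * x by apply/andP; split; nra.
    move=> /andP[? ?]; nra.
  (* Both squares together give |y (e - 1)| <= y^2 + (e - 1)^2/4 <= y^2 + x^2. *)
  have := sqr_ge0 (2 * y + (e - 1)); have := sqr_ge0 (2 * y - (e - 1)).
  move: eS => /andP[? ?] ? ?.
  rewrite ler_norml; apply/andP; split; lra.
lra.
Qed.

(** * The normalized coefficients on a box *)

Definition geoG (R : realType) (P : nat -> {poly CC R}) (n : nat) (w : CC R) : CC R :=
  w ^+ n.+1 * geo_coef P (cexp (- w)) n.

Lemma cexpN_neq1 (R : realType) (M : R) (w : CC R) : box M pi w -> cexp (- w) != 1.
Proof.
move=> wB; have := cmod_one_sub_cexpN_ge wB; apply: contraTneq => ->.
rewrite subrr cmod0 -ltNge mulr_gt0 ?divr_gt0 ?expR_gt0//.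
by rewrite cmod_gt0; case: wB.
Qed.

Lemma box_cmod_le (R : realType) (M d : R) (w : CC R) : box M d w -> cmod w <= M + d.
Proof. by case=> _ wM wd; rewrite (le_trans (cmod_le_ReIm _))// lerD. Qed.

(** A quantitative form of f(w) -> 1 as w -> 0. The linear rate makes the error shrink by a factor 3
    under w -> w/3. *)
Definition near1 (R : realType) (M : R) (f : CC R -> CC R) :=
  exists2 D : R, 0 <= D & forall w, box M pi w -> cmod (f w - 1) <= D * cmod w.

Definition bounded_on_box (R : realType) (M : R) (f : CC R -> CC R) :=
  exists2 D : R, 0 <= D & forall w, box M pi w -> cmod (f w) <= D.

Lemma near1_bounded (R : realType) (M : R) (f : CC R -> CC R) :
  0 <= M -> near1 M f -> bounded_on_box M f.
Proof.
move=> M0 [D D0 fD]; exists (D * (M + pi) + 1).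
  by rewrite addr_ge0// mulr_ge0// addr_ge0// pi_ge0.
move=> w wB; rewrite -(subrK 1 (f w)) (le_trans (le_cmodD _ _))// cmod1 lerD2r.
by rewrite (le_trans (fD w wB))// ler_wpM2l// box_cmod_le.
Qed.

(** Away from 0 the linear rate costs nothing: |w| > 1/2 gives D + 1 <= 2 (D + 1) |w|. *)
Lemma near1_of_local (R : realType) (M C D : R) (f : CC R -> CC R) :
  0 <= C -> 0 <= D ->
  (forall w, box M pi w -> cmod w <= 2^-1 -> cmod (f w - 1) <= C * cmod w) ->
  (forall w, box M pi w -> cmod (f w) <= D) -> near1 M f.
Proof.
move=> C0 D0 fC fD; exists (C + 2 * (D + 1)) => [|w wB].
  by rewrite addr_ge0// mulr_ge0// addr_ge0.
have [w2|w2] := leP (cmod w) 2^-1.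
  rewrite (le_trans (fC w wB w2))// ler_wpM2r ?cmod_ge0// lerDl mulr_ge0//.
  by rewrite addr_ge0.
have h : cmod (f w - 1) <= D + 1.
  by rewrite (le_trans (le_cmodD _ _))// cmodN cmod1 lerD2r fD.
have := cmod_ge0 w; nra.
Qed.

Lemma near1M (R : realType) (M : R) (f g : CC R -> CC R) :
  0 <= M -> near1 M f -> near1 M g -> near1 M (fun w => f w * g w).
Proof.
move=> M0 f1 [D D0 gD]; have [B B0 fB] := near1_bounded M0 f1.
have [C C0 fC] := f1.
exists (B * D + C) => [|w wB]; first by rewrite addr_ge0// mulr_ge0.
have -> : f w * g w - 1 = f w * (g w - 1) + (f w - 1) by ring.
rewrite (le_trans (le_cmodD _ _))// mulrDl lerD ?fC// cmodM -mulrA.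
by rewrite ler_pM ?cmod_ge0 ?fB ?gD.
Qed.

Lemma near1D_mul_id (R : realType) (M : R) (f g : CC R -> CC R) :
  near1 M f -> bounded_on_box M g -> near1 M (fun w => f w + w * g w).
Proof.
move=> [C C0 fC] [D D0 gD]; exists (C + D) => [|w wB]; first by rewrite addr_ge0.
have -> : f w + w * g w - 1 = (f w - 1) + g w * w by ring.
rewrite (le_trans (le_cmodD _ _))// mulrDl lerD ?fC// cmodM.
by rewrite ler_wpM2r ?cmod_ge0 ?gD.
Qed.

Lemma near1_cexpN (R : realType) (M : R) : near1 M (fun w => cexp (- w)).
Proof.
apply: (@near1_of_local _ _ 4 (expR M)) => [||w wB w2|w [_ wM _]] //.
- have -> : cexp (- w) - 1 = - ((1 - cexp (- w) - w) + w) by ring.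
  rewrite cmodN (le_trans (le_cmodD _ _))//; have := cmod_cexp_sub_le w2.
  have := cmod_ge0 w; nra.
- rewrite cmod_cexp ler_expR; case: w wM => x y /=.
  by rewrite -normrN; apply: le_trans; rewrite ler_norm.
Qed.

Lemma near1_id_div (R : realType) (M : R) : near1 M (fun w => w / (1 - cexp (- w))).
Proof.
have k0 : 0 < expR (- M) / 2 by rewrite divr_gt0// expR_gt0.
have ki0 : 0 <= (expR (- M) / 2)^-1 by rewrite invr_ge0 ltW.
have neq w : box M pi w -> 0 < cmod (1 - cexp (- w)).
  by move=> wB; rewrite cmod_gt0 subr_eq0 eq_sym; exact: cexpN_neq1 wB.
apply: (near1_of_local (C := 5 / (expR (- M) / 2)) (D := (expR (- M) / 2)^-1)) => //.
- move=> w wB w2; have h := cmod_one_sub_cexpN_ge wB; have n0 := neq w wB.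
  have -> : w / (1 - cexp (- w)) - 1 = - ((1 - cexp (- w) - w) / (1 - cexp (- w))).
    by field; move: n0; rewrite cmod_gt0.
  rewrite cmodN cmodM cmodV ler_pdivrMr// (le_trans (cmod_cexp_sub_le w2))//.
  rewrite -!mulrA ler_pM2l// expr2 mulrCA ler_wpM2l ?cmod_ge0//.
  by rewrite mulrC ler_pdivlMr// mulrC.
- move=> w wB; have h := cmod_one_sub_cexpN_ge wB; have n0 := neq w wB.
  by rewrite cmodM cmodV ler_pdivrMr// mulrC ler_pdivlMr// mulrC.
Qed.

Lemma bounded_on_box_sum (R : realType) (M : R) n (f : 'I_n -> CC R -> CC R) :
  (forall i, bounded_on_box M (f i)) -> bounded_on_box M (fun w => \sum_(i < n) f i w).
Proof.
elim: n f => [|n IHn] f fB.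
  by exists 0 => // w _; rewrite big_ord0 cmod0.
have [C C0 hC] := IHn _ (fun i => fB (widen_ord (leqnSn n) i)).
have [D D0 hD] := fB ord_max.
exists (C + D) => [|w wB]; first by rewrite addr_ge0.
by rewrite big_ord_recr/= (le_trans (le_cmodD _ _))// lerD ?hC ?hD.
Qed.

Lemma bounded_on_boxM (R : realType) (M : R) (f g : CC R -> CC R) :
  bounded_on_box M f -> bounded_on_box M g -> bounded_on_box M (fun w => f w * g w).
Proof.
move=> [C C0 fC] [D D0 gD]; exists (C * D) => [|w wB]; first exact: mulr_ge0.
by rewrite cmodM ler_pM ?cmod_ge0 ?fC ?gD.
Qed.

Lemma bounded_on_box_exp (R : realType) (M : R) n :
  0 <= M -> bounded_on_box M (fun w => w ^+ n).
Proof.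
move=> M0; have R0 : 0 <= M + pi by rewrite addr_ge0// pi_ge0.
exists ((M + pi) ^+ n) => [|w wB]; first exact: exprn_ge0.
by rewrite cmodX lerXn2r// ?nnegrE ?cmod_ge0// box_cmod_le.
Qed.

Lemma geoG0 (R : realType) (P : nat -> {poly CC R}) (M : R) (w : CC R) :
  is_geometric_polynomials P -> box M pi w -> geoG P 0 w = w / (1 - cexp (- w)).
Proof.
move=> hP wB; have x1 := cexpN_neq1 wB.
have x1' : 1 - cexp (- w) != 0 by rewrite subr_eq0 eq_sym.
rewrite /geoG expr1; congr (_ * _); apply: (mulIf x1').
by rewrite geo_coef_rec// big_ord0 mulr0 addr0 mulVf.
Qed.

(** The recurrence multiplied by w^(n+2). As w^(n+2) c_j = w^(n+1-j) G_j, the terms j < n carry at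
    least one more factor w than the term j = n, which alone contributes to the limit at w = 0. *)
Lemma geoGS (R : realType) (P : nat -> {poly CC R}) (M : R) (w : CC R) n :
  is_geometric_polynomials P -> box M pi w ->
  geoG P n.+1 w = w / (1 - cexp (- w)) * cexp (- w) *
    (geoG P n w + w * \sum_(j < n) w ^+ (n - j.+1) * (n.+1 - j)`!%:R^-1 * geoG P j w).
Proof.
move=> hP wB; have x1 := cexpN_neq1 wB.
have x1' : 1 - cexp (- w) != 0 by rewrite subr_eq0 eq_sym.
apply: (mulIf x1'); rewrite {1}/geoG -[LHS]mulrA geo_coef_rec//= add0r.
rewrite big_ord_recr/= subSnn divr1 mulrDr mulrDr addrC.
have -> : w / (1 - cexp (- w)) * cexp (- w) *
    (geoG P n w +
     w * (\sum_(j < n) w ^+ (n - j.+1) * (n.+1 - j)`!%:R^-1 * geoG P j w)) *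
    (1 - cexp (- w)) = w * cexp (- w) * geoG P n w + cexp (- w) *
  (w ^+ 2 * (\sum_(j < n) w ^+ (n - j.+1) * (n.+1 - j)`!%:R^-1 * geoG P j w)).
  by field.
congr (_ + _).
  by rewrite /geoG exprS; ring.
rewrite mulrCA; congr (_ * _); rewrite !mulr_sumr; apply: eq_bigr => i _.
rewrite /geoG; have -> : w ^+ n.+2 = w ^+ 2 * w ^+ (n - i.+1) * w ^+ i.+1.
  by rewrite -!exprD; congr (_ ^+ _); have := ltn_ord i; lia.
by ring.
Qed.

Lemma near1_ext (R : realType) (M : R) (f g : CC R -> CC R) :
  (forall w, box M pi w -> f w = g w) -> near1 M f -> near1 M g.
Proof. by move=> fg [D D0 fD]; exists D => // w wB; rewrite -fg// fD. Qed.

(** Strong induction through [geoGS]. The constant depends on n without control; later, at fixed n,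
    it is only met multiplied by 2^-j with j arbitrary. *)
Lemma near1_geoG (R : realType) (P : nat -> {poly CC R}) (M : R) n :
  is_geometric_polynomials P -> 0 <= M -> near1 M (geoG P n).
Proof.
move=> hP M0; elim/ltn_ind: n => -[_|n IHn].
  by apply: near1_ext (near1_id_div M) => w wB; rewrite (geoG0 hP wB).
apply: near1_ext (near1M M0 (near1M M0 (near1_id_div M) (near1_cexpN M))
  (near1D_mul_id (IHn n (ltnSn n)) _)); first by move=> w wB; rewrite (geoGS n hP wB).
apply: bounded_on_box_sum => i; apply: bounded_on_boxM.
  apply: bounded_on_boxM; first exact: bounded_on_box_exp.
  exists (cmod ((n.+1 - i)`!%:R^-1 : CC R)); first exact: cmod_ge0.
  by [].
by apply: near1_bounded => //; apply: IHn; rewrite ltnS ltnW.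
Qed.

(** * The trisection formula for the normalized coefficients *)

Definition two_pi_i (R : realType) : CC R := Complex 0 (pi *+ 2).

Lemma cexp_two_pi_i (R : realType) : cexp (two_pi_i R) = 1.
Proof. by rewrite /cexp/= expR0 cos2pi sin2pi mulr1 mulr0. Qed.

Lemma Re_natV3 (R : realType) (w : CC R) : complex.Re (w / 3) = complex.Re w / 3.
Proof.
have -> : (3^-1 : CC R) = (3^-1 : R)%:C%C by rewrite fmorphV rmorph_nat.
by case: w => x y /=; rewrite mulr0 subr0.
Qed.

Lemma Im_natV3 (R : realType) (w : CC R) : complex.Im (w / 3) = complex.Im w / 3.
Proof.
have -> : (3^-1 : CC R) = (3^-1 : R)%:C%C by rewrite fmorphV rmorph_nat.
by case: w => x y /=; rewrite mulr0 add0r.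
Qed.

Lemma geoG_trisection (R : realType) (P : nat -> {poly CC R}) (M : R) (w : CC R) n :
  is_geometric_polynomials P -> box M pi w ->
  let t := two_pi_i R in
  geoG P n w = geoG P n (w / 3) + geoG P n ((w - t) / 3) * (w / (w - t)) ^+ n.+1
    + geoG P n ((w + t) / 3) * (w / (w + t)) ^+ n.+1.
Proof.
move=> hP wB t; have pi0 : 0 < pi :> R := pi_gt0 R.
have pi2 : pi < `|pi *+ 2 : R|.
  rewrite gtr0_norm; last by rewrite pmulrn_lgt0.
  by have E : pi *+ 2 = pi + pi :> R := mulr2n pi; rewrite E ltrDl.
have [w0 wM wpi] := wB.
have wBt : w - t != 0.
  apply: contraTneq wpi => /subr0_eq ->; rewrite -ltNge /=.
  exact: pi2.
have wDt : w + t != 0.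
  apply: contraTneq wpi => /eqP; rewrite addr_eq0 => /eqP ->; rewrite -ltNge /=.
  by rewrite normrN; exact: pi2.
pose om := cexp (t / 3).
have om3 : om ^+ 3 = 1.
  have <- : cexp t = 1 := cexp_two_pi_i R.
  by have {1}-> : t = t / 3 + t / 3 + t / 3 by [field]; rewrite !cexpD -/om; ring.
have om1 : om != 1.
  rewrite /om -(opprK (t / 3)); apply: (@cexpN_neq1 _ 0); split.
  - rewrite oppr_eq0 mulf_neq0 ?invr_neq0 ?pnatr_eq0//.
    by rewrite eq_complex/= eqxx/= mulrn_eq0/= gt_eqF.
  - by rewrite -mulNr Re_natV3/= oppr0 mul0r normr0.
  - by rewrite -mulNr Im_natV3/= mulNr normrN ger0_norm; lra.
have om0 : 1 + om + om ^+ 2 = 0.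
  apply: (@mulfI _ (om - 1)); first by rewrite subr_eq0.
  by rewrite mulr0; transitivity (om ^+ 3 - 1); [ring | rewrite om3 subrr].
pose y := cexp (- (w / 3)).
have y3 : y ^+ 3 = cexp (- w).
  have -> : - w = - (w / 3) + - (w / 3) + - (w / 3) by field.
  by rewrite !cexpD -/y; ring.
have y31 : y ^+ 3 != 1 by rewrite y3; exact: cexpN_neq1 wB.
have := geo_coef_trisection n hP om0 y31; rewrite y3.
have -> : om * y = cexp (- ((w - t) / 3)).
  by rewrite -cexpD; congr cexp; field.
(* Reading om^2 as e^(-t/3) rather than e^(2t/3) produces the point (w + t)/3, which stays in the
   closed strip, instead of (w - 2t)/3. *)
have -> : om ^+ 2 * y = cexp (- ((w + t) / 3)).
  have -> : om ^+ 2 = cexp (- (t / 3)).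
    by rewrite cexpN -/om; apply: (mulfI (cexp_neq0 (t / 3)));
      rewrite -exprS om3 divff ?cexp_neq0.
  by rewrite -cexpD; congr cexp; field.
rewrite /geoG -/y => h.
have n3 : (3 ^+ n.+1 : CC R) != 0 by rewrite expf_neq0 ?pnatr_eq0.
apply: (mulfI n3); rewrite mulrCA h !expr_div_n.
have n1 : (w - t) ^+ n.+1 != 0 by rewrite expf_neq0.
have n2 : (w + t) ^+ n.+1 != 0 by rewrite expf_neq0.
move: n1 n2 n3; move: ((w - t) ^+ n.+1) ((w + t) ^+ n.+1) (3 ^+ n.+1) => a b c n1 n2 n3.
by field; rewrite n1 n2 n3.
Qed.

(** * Uniform convergence *)

Lemma geometric_small (R : realType) (r c e : R) : 0 <= r < 1 -> 0 < e ->
  exists N, forall n, (N <= n)%N -> c * r ^+ n <= e.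
Proof.
move=> /andP[r0 r1] e0.
have : (fun n => c * r ^+ n) @ \oo --> c * 0.
  by apply: cvgMr; apply: cvg_expr; rewrite ger0_norm.
rewrite mulr0 => /cvgrPdist_le/(_ e e0)[N _ h]; exists N => n Nn.
by have := h n Nn; rewrite /= sub0r normrN; apply: le_trans; exact: ler_norm.
Qed.

Lemma le_of_halvings (R : realType) (x a b : R) :
  (forall j, x <= b * 2^-1 ^+ j + a) -> x <= a.
Proof.
move=> h; apply/ler_addgt0Pl => e e0.
have r2 : 0 <= (2^-1 : R) < 1 by lra.
by have [N /(_ N (leqnn N)) bN] := geometric_small b r2 e0; rewrite (le_trans (h N))// lerD2r.
Qed.

Lemma box_sub (R : realType) (M d d' : R) (w : CC R) :
  d <= d' -> box M d w -> box M d' w.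
Proof. by move=> dd [w0 wM wd]; split=> //; exact: le_trans dd. Qed.

Lemma box_div3 (R : realType) (M d : R) (w : CC R) : box M d w -> box M d (w / 3).
Proof.
move=> [w0 wM wd]; split; first by rewrite mulf_neq0// invr_eq0 pnatr_eq0.
- rewrite Re_natV3 normrM (ger0_norm (_ : 0 <= 3^-1)) ?invr_ge0//.
  by have := normr_ge0 (complex.Re w); lra.
- rewrite Im_natV3 normrM (ger0_norm (_ : 0 <= 3^-1)) ?invr_ge0//.
  by have := normr_ge0 (complex.Im w); lra.
Qed.

Lemma Im_sub_two_pi_i (R : realType) (w : CC R) :
  complex.Im (w - two_pi_i R) = complex.Im w - 2 * pi.
Proof. by case: w => x y /=; rewrite mulr_natl. Qed.

Lemma Im_add_two_pi_i (R : realType) (w : CC R) :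
  complex.Im (w + two_pi_i R) = complex.Im w + 2 * pi.
Proof. by case: w => x y /=; rewrite mulr_natl. Qed.

Lemma Re_sub_two_pi_i (R : realType) (w : CC R) :
  complex.Re (w - two_pi_i R) = complex.Re w.
Proof. by case: w => x y /=; rewrite subr0. Qed.

Lemma Re_add_two_pi_i (R : realType) (w : CC R) :
  complex.Re (w + two_pi_i R) = complex.Re w.
Proof. by case: w => x y /=; rewrite addr0. Qed.

Lemma box_shift (R : realType) (M d : R) (w u : CC R) : 0 <= M -> 0 <= d ->
  0 < `|complex.Im u| <= 3 * d -> complex.Re u = complex.Re w -> `|complex.Re w| <= M ->
  box M d (u / 3).
Proof.
move=> M0 d0 /andP[u0 ud] uw wM; split.
- rewrite mulf_neq0 ?invr_eq0 ?pnatr_eq0//; apply: contraTneq u0 => ->.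
  by rewrite normr0 ltxx.
- rewrite Re_natV3 uw normrM (ger0_norm (_ : 0 <= 3^-1)) ?invr_ge0//.
  by have := normr_ge0 (complex.Re w); lra.
- by rewrite Im_natV3 normrM (ger0_norm (_ : 0 <= 3^-1)) ?invr_ge0//; lra.
Qed.

(** |w - 2 pi i|^2 - |w|^2 = 4 pi (pi - Im w). *)
Lemma sqr_cmod_sub_two_pi_i (R : realType) (d : R) (w : CC R) :
  complex.Im w <= pi - d ->
  cmod w ^+ 2 + 4 * pi * d <= cmod (w - two_pi_i R) ^+ 2.
Proof.
rewrite !sqr_cmod Re_sub_two_pi_i Im_sub_two_pi_i => wd.
have := pi_gt0 R; move: (pi : R) wd => p wd p0.
by rewrite -addrA lerD2l; nra.
Qed.

Lemma sqr_cmod_add_two_pi_i (R : realType) (d : R) (w : CC R) :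
  - (pi - d) <= complex.Im w ->
  cmod w ^+ 2 + 4 * pi * d <= cmod (w + two_pi_i R) ^+ 2.
Proof.
rewrite !sqr_cmod Re_add_two_pi_i Im_add_two_pi_i => wd.
have := pi_gt0 R; move: (pi : R) wd => p wd p0.
by rewrite -addrA lerD2l; nra.
Qed.

Lemma ratio_exp_le (R : realType) (M d : R) : 0 <= M -> 0 < d ->
  exists K r : R, [/\ 0 <= K, 0 <= r < 1 & forall (w u : CC R) n, box M pi w ->
    cmod w ^+ 2 + 4 * pi * d <= cmod u ^+ 2 ->
    cmod ((w / u) ^+ n.+1) <= K * r ^+ n * cmod w].
Proof.
move=> M0 d0; have pi0 := pi_gt0 R; pose s := 4 * pi * d; pose Q := (M + pi) ^+ 2.
have s0 : 0 < s by rewrite /s !mulr_gt0.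
have Q0 : 0 <= Q by rewrite sqr_ge0.
have QS : 0 < Q + s by rewrite ltr_wpDl.
(* From |w|^2 <= Q and |u|^2 >= |w|^2 + s follows |w/u|^2 <= Q/(Q + s). One of the n+1 factors is
   set aside and bounded by |w|/sqrt s, which keeps the factor |w|. *)
exists (Num.sqrt s)^-1, (Num.sqrt (Q / (Q + s))); split.
- by rewrite invr_ge0 sqrtr_ge0.
- rewrite sqrtr_ge0/= -sqrtr1 ltr_sqrt// ltr_pdivrMr// mul1r ltrDl//.
move=> w u n wB wu; have wR := box_cmod_le wB.
have w0 := cmod_ge0 w; have u0 := cmod_ge0 u.
have up : 0 < cmod u.
  by rewrite lt0r u0 andbT; apply: contraTneq wu => ->; rewrite expr0n -ltNge ltr_wpDl ?sqr_ge0.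
have u2 : 0 < cmod u ^+ 2 by rewrite exprn_gt0.
have wQ : cmod w ^+ 2 <= Q by rewrite lerXn2r// nnegrE (le_trans w0).
have -> (a b c : R) : a * b * c = b * (a * c) by ring.
rewrite cmodX exprSr cmodM cmodV.
have r0 : 0 <= cmod w / cmod u by rewrite divr_ge0.
apply: ler_pM; rewrite ?exprn_ge0//.
  rewrite lerXn2r ?nnegrE ?sqrtr_ge0// -(ger0_norm r0) -sqrtr_sqr ler_wsqrtr//.
  rewrite expr_div_n ler_pdivrMr// [leRHS]mulrAC ler_pdivlMr//; move: wu; rewrite -/s; nra.
rewrite mulrC ler_wpM2r// lef_pV2 ?posrE ?sqrtr_gt0// -(ger0_norm u0) -sqrtr_sqr.
rewrite ler_wsqrtr// (le_trans _ wu)// -/s; nra.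
Qed.

Lemma le_cmodD3 (R : realType) (a b c : CC R) :
  cmod (a + b + c) <= cmod a + cmod b + cmod c.
Proof. by rewrite (le_trans (le_cmodD _ _))// lerD2r le_cmodD. Qed.

(** The two side terms of the trisection formula bound G_n(w) - G_n(w/3) by 2 A K r^n |w|;
    telescoping along w/3^j down to 0 loses at most another factor 2. [A] has to bound this single
    G_n only, so it may depend on n. *)
Lemma geoG_sub_le (R : realType) (P : nat -> {poly CC R}) (M d K r A : R) n :
  is_geometric_polynomials P -> 0 <= M -> 0 < d < pi -> 0 <= K -> 0 <= r -> 0 <= A ->
  (forall (w u : CC R) n, box M pi w ->
    cmod w ^+ 2 + 4 * pi * d <= cmod u ^+ 2 ->
    cmod ((w / u) ^+ n.+1) <= K * r ^+ n * cmod w) ->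
  (forall w, box M pi w -> cmod (geoG P n w) <= A) ->
  forall w, box M (pi - d) w ->
    cmod (geoG P n w - 1) <= 4 * A * K * r ^+ n * cmod w.
Proof.
move=> hP M0 /andP[d0 dpi] K0 r0 A0 hK hA.
have pi0 := pi_gt0 R; have pige0 := ltW pi0; have dp : pi - d <= pi by lra.
pose E := 2 * A * K * r ^+ n.
have E0 : 0 <= E by rewrite /E !mulr_ge0// exprn_ge0.
have step w : box M (pi - d) w -> cmod (geoG P n w - geoG P n (w / 3)) <= E * cmod w.
  move=> wB; have wBpi := box_sub dp wB; have [_ wM wd] := wB.
  have [wd1 wd2] : - (pi - d) <= complex.Im w /\ complex.Im w <= pi - d.
    by move: wd; rewrite ler_norml => /andP.
  have aux (a b c : CC R) : a + b + c - a = b + c by ring.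
  rewrite (geoG_trisection n hP wBpi) aux (le_trans (le_cmodD _ _))//.
  have -> : E * cmod w = A * (K * r ^+ n * cmod w) + A * (K * r ^+ n * cmod w).
    by rewrite /E; ring.
  apply: lerD; rewrite cmodM ler_pM ?cmod_ge0//.
  - apply: hA; apply: (box_shift (w := w)) => //; rewrite ?Re_sub_two_pi_i//.
    by rewrite Im_sub_two_pi_i normr_gt0 ler_norml lt_eqF/=; lra.
  - by apply: hK => //; exact: sqr_cmod_sub_two_pi_i.
  - apply: hA; apply: (box_shift (w := w)) => //; rewrite ?Re_add_two_pi_i//.
    by rewrite Im_add_two_pi_i normr_gt0 ler_norml gt_eqF/=; lra.
  - by apply: hK => //; exact: sqr_cmod_add_two_pi_i.
have [D D0 hD] := near1_geoG n hP M0.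
(* The exact sum of the errors is 3/2 E |w| and the exact contraction 1/3; both are relaxed, to 2 E
   |w| and 1/2. *)
have halve j w : box M (pi - d) w ->
    cmod (geoG P n w - 1) <= (D * 2^-1 ^+ j + 2 * E) * cmod w.
  elim: j w => [|j IHj] w wB.
    rewrite expr0 mulr1 (le_trans (hD _ (box_sub dp wB)))// ler_wpM2r ?cmod_ge0//.
    by rewrite lerDl mulr_ge0.
  rewrite -(subrK (geoG P n (w / 3)) (geoG P n w)) -addrA (le_trans (le_cmodD _ _))//.
  have := step w wB; have := IHj _ (box_div3 wB); rewrite cmodM cmodV cmod_nat exprS.
  have := cmod_ge0 w; have : 0 <= D * 2^-1 ^+ j by rewrite mulr_ge0// exprn_ge0.
  rewrite (mulrCA D); move: (D * 2^-1 ^+ j) => B B0 w0 h1 h2.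
  rewrite (le_trans (lerD h2 h1))//.
  have : 0 <= B * cmod w by rewrite mulr_ge0.
  have : 0 <= E * cmod w by rewrite mulr_ge0.
  lra.
move=> w wB; have w0 := cmod_ge0 w.
apply: (le_of_halvings (b := D * cmod w)) => j.
rewrite (le_trans (halve j w wB))// le_eqVlt; apply/orP; left; apply/eqP.
by rewrite /E; ring.
Qed.

(** A bootstrap at fixed n. The threshold N is chosen before the bound A that is being improved, so
    it does not depend on the n-dependent starting bound. *)
Lemma geoG_uniformly_bounded (R : realType) (P : nat -> {poly CC R}) (M : R) :
  is_geometric_polynomials P -> 0 <= M ->
  exists N, forall n w, (N <= n)%N -> box M pi w -> cmod (geoG P n w) <= 4.
Proof.
move=> hP M0; have pi0 := pi_gt0 R; have pige0 := ltW pi0.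
(* The inner strip is |Im| <= pi - pi/3 = 2 pi/3: it contains w/3 and whichever of (w +- 2 pi i)/3
   comes with a ratio possibly of modulus 1. *)
have d0 : 0 < pi / 3 :> R by rewrite divr_gt0.
have dp : 0 < (pi / 3 : R) < pi by rewrite d0/=; lra.
have [K [r [K0 r01 hK]]] := ratio_exp_le M0 d0.
have r0 : 0 <= r by case/andP: r01.
have R0 : 0 <= M + pi by rewrite addr_ge0// ltW.
have half_gt0 : 0 < 2^-1 :> R by lra.
(* With B = A K r^n (M + pi) the three terms below are bounded by 1 + 4 B, 1 + 4 B and B, so 9 B <=
   A/2 is what is needed. *)
have [N hN] := geometric_small (9 * K * (M + pi)) r01 half_gt0.
exists N => n w Nn; have Kn := hN n Nn.
have improve A : 0 <= A -> (forall w, box M pi w -> cmod (geoG P n w) <= A) ->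
    forall w, box M pi w -> cmod (geoG P n w) <= 2 + A / 2.
  move=> A0 hA {}w wB; have [w0 wM wpi] := wB.
  have wR := box_cmod_le wB.
  have S := geoG_sub_le hP M0 dp K0 r0 A0 hK hA.
  pose B := A * (K * r ^+ n * (M + pi)).
  have Krn : 0 <= K * r ^+ n by rewrite mulr_ge0// exprn_ge0.
  have inner v : box M (pi - pi / 3) v -> cmod (geoG P n v) <= 1 + 4 * B.
    move=> vB; rewrite -(subrK 1 (geoG P n v)) (le_trans (le_cmodD _ _))//.
    rewrite cmod1 addrC lerD2l (le_trans (S v vB))//.
    have -> : 4 * A * K * r ^+ n * cmod v = 4 * A * (K * r ^+ n) * cmod v by ring.
    have -> : 4 * B = 4 * A * (K * r ^+ n) * (M + pi) by rewrite /B; ring.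
    rewrite ler_wpM2l ?mulr_ge0 ?exprn_ge0//.
    apply: box_cmod_le.
    by apply: box_sub vB; lra.
  have far u v : cmod w ^+ 2 + 4 * pi * (pi / 3) <= cmod u ^+ 2 -> box M pi v ->
      cmod (geoG P n v * (w / u) ^+ n.+1) <= B.
    move=> wu vB; rewrite cmodM ler_pM ?cmod_ge0 ?hA//.
    by rewrite (le_trans (hK w u n wB wu))// ler_wpM2l.
  have close u v : cmod w ^+ 2 + 4 * pi * 0 <= cmod u ^+ 2 ->
      box M (pi - pi / 3) v -> cmod (geoG P n v * (w / u) ^+ n.+1) <= 1 + 4 * B.
    rewrite mulr0 addr0 => wu vB; rewrite cmodM -[leRHS]mulr1 ler_pM ?cmod_ge0 ?inner//.
    rewrite cmodX exprn_ile1 ?cmod_ge0// cmodM cmodV.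
    have [->|u0] := eqVneq u 0; first by rewrite cmod0 invr0 mulr0.
    have cu : 0 < cmod u by rewrite cmod_gt0.
    by rewrite ler_pdivrMr// mul1r -(ler_sqr (cmod_ge0 _) (cmod_ge0 _)).
  have B2 : 9 * B <= A / 2.
    have -> : 9 * B = A * (9 * K * (M + pi) * r ^+ n) by rewrite /B; ring.
    by rewrite ler_wpM2l.
  have w3 : box M (pi - pi / 3) (w / 3).
    have [? ? wpi3] := box_div3 wB; split=> //.
    rewrite Im_natV3 normrM (ger0_norm (_ : 0 <= 3^-1)) ?invr_ge0//; lra.
  have dm : 0 <= pi - pi / 3 :> R by lra.
  move: wpi; rewrite (geoG_trisection n hP wB) ler_norml => /andP[wpi1 wpi2].
  have [y0|y0] := leP 0 (complex.Im w).
    have h1 : cmod (geoG P n ((w - two_pi_i R) / 3) * (w / (w - two_pi_i R)) ^+ n.+1) <= 1 + 4 * B.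
      apply: close; first by apply: sqr_cmod_sub_two_pi_i; rewrite subr0.
      apply: (box_shift (w := w)) => //; rewrite ?Re_sub_two_pi_i//.
      by rewrite Im_sub_two_pi_i normr_gt0 ler_norml lt_eqF/=; lra.
    have h2 : cmod (geoG P n ((w + two_pi_i R) / 3) * (w / (w + two_pi_i R)) ^+ n.+1) <= B.
      apply: far; first by apply: sqr_cmod_add_two_pi_i; lra.
      apply: (box_shift (w := w)) => //; rewrite ?Re_add_two_pi_i//.
      by rewrite Im_add_two_pi_i normr_gt0 ler_norml gt_eqF/=; lra.
    rewrite (le_trans (le_cmodD3 _ _ _))// (le_trans (lerD (lerD (inner _ w3) h1) h2))//.
    by have -> : 1 + 4 * B + (1 + 4 * B) + B = 2 + 9 * B by [ring]; rewrite lerD2l.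
  have h1 : cmod (geoG P n ((w + two_pi_i R) / 3) * (w / (w + two_pi_i R)) ^+ n.+1) <= 1 + 4 * B.
    apply: close; first by apply: sqr_cmod_add_two_pi_i; rewrite subr0.
    apply: (box_shift (w := w)) => //; rewrite ?Re_add_two_pi_i//.
    by rewrite Im_add_two_pi_i normr_gt0 ler_norml gt_eqF/=; lra.
  have h2 : cmod (geoG P n ((w - two_pi_i R) / 3) * (w / (w - two_pi_i R)) ^+ n.+1) <= B.
    apply: far; first by apply: sqr_cmod_sub_two_pi_i; lra.
    apply: (box_shift (w := w)) => //; rewrite ?Re_sub_two_pi_i//.
    by rewrite Im_sub_two_pi_i normr_gt0 ler_norml lt_eqF/=; lra.
  rewrite (le_trans (le_cmodD3 _ _ _))// (le_trans (lerD (lerD (inner _ w3) h2) h1))//.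
  by have -> : 1 + 4 * B + B + (1 + 4 * B) = 2 + 9 * B by [ring]; rewrite lerD2l.
have [C C0 hC] := near1_bounded M0 (near1_geoG n hP M0).
(* Since 2 + (x + 4)/2 = x/2 + 4, each improvement halves the excess over 4. *)
have iter j : forall w, box M pi w -> cmod (geoG P n w) <= C * 2^-1 ^+ j + 4.
  elim: j => [|j IHj] v vB; first by rewrite expr0 mulr1 (le_trans (hC v vB))// lerDl.
  have A0 : 0 <= C * 2^-1 ^+ j + 4 by rewrite addr_ge0// mulr_ge0// exprn_ge0.
  rewrite (le_trans (improve _ A0 IHj v vB))// exprS; lra.
by move=> wB; apply: (le_of_halvings (b := C)) => j; exact: iter.
Qed.

Lemma geoG_cvg_uniform (R : realType) (P : nat -> {poly CC R}) (M d e : R) :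
  is_geometric_polynomials P -> 0 <= M -> 0 < d < pi -> 0 < e ->
  exists N, forall n w, (N <= n)%N -> box M (pi - d) w -> cmod (geoG P n w - 1) <= e.
Proof.
move=> hP M0 dpi e0; have pi0 := pi_gt0 R; have pige0 := ltW pi0.
have d0 : 0 < d by case/andP: dpi.
have [K [r [K0 r01 hK]]] := ratio_exp_le M0 d0.
have r0 : 0 <= r by case/andP: r01.
have [N1 h1] := geoG_uniformly_bounded hP M0.
have [N2 h2] := geometric_small (16 * K * (M + pi)) r01 e0.
exists (maxn N1 N2) => n w; rewrite geq_max => /andP[n1 n2] wB.
have h4 v : box M pi v -> cmod (geoG P n v) <= 4 by exact: h1.
have := geoG_sub_le hP M0 dpi K0 r0 (ler0n R 4) hK h4 wB.
move/le_trans; apply; rewrite (le_trans _ (h2 n n2))//.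
have -> : 16 * K * (M + pi) * r ^+ n = 4 * 4 * K * r ^+ n * (M + pi) by ring.
rewrite ler_wpM2l// ?mulr_ge0// ?exprn_ge0//.
by apply: box_cmod_le; apply: box_sub wB; lra.
Qed.

(** * The logarithm and the Riemann sphere *)

Lemma Re_clog (R : realType) (q : CC R) : complex.Re (clog q) = ln (cmod q).
Proof. by case: q. Qed.

Lemma Re_div_cmod_itv (R : realType) (q : CC R) :
  -1 <= complex.Re q / cmod q <= 1.
Proof.
have [->|q0] := eqVneq q 0; first by rewrite mul0r oppr_le0 ler01.
rewrite -ler_norml normrM normfV (ger0_norm (cmod_ge0 q)).
by rewrite ler_pdivrMr ?cmod_gt0// mul1r norm_Re_le.
Qed.

Lemma Im_clog (R : realType) (q : CC R) :
  complex.Im (clog q) = if 0 <= complex.Im q then acos (complex.Re q / cmod q)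
                        else - acos (complex.Re q / cmod q).
Proof. by case: q. Qed.

Lemma norm_Im_clog (R : realType) (q : CC R) :
  `|complex.Im (clog q)| = acos (complex.Re q / cmod q).
Proof.
have a0 := acos_ge0 (Re_div_cmod_itv q).
by rewrite Im_clog; case: ifP => _; rewrite ?normrN ger0_norm.
Qed.

Lemma clogK (R : realType) (q : CC R) : q != 0 -> cexp (clog q) = q.
Proof.
move=> q0; have cq : 0 < cmod q by rewrite cmod_gt0.
have aK := acosK (Re_div_cmod_itv q : _ \in `[(-1), 1]).
have cosI : cos (complex.Im (clog q)) = complex.Re q / cmod q.
  by rewrite -cos_norm norm_Im_clog aK.
have sinI : sin (complex.Im (clog q)) = complex.Im q / cmod q.
  have sa : sin (acos (complex.Re q / cmod q)) = `|complex.Im q| / cmod q.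
    rewrite sin_acos ?Re_div_cmod_itv//.
    have -> : 1 - (complex.Re q / cmod q) ^+ 2 = (complex.Im q / cmod q) ^+ 2.
      rewrite !expr_div_n -[1](divff (lt0r_neq0 (exprn_gt0 2 cq))) -mulrBl.
      by rewrite sqr_cmod [X in X - _]addrC addrK.
    by rewrite sqrtr_sqr normrM normfV (ger0_norm (cmod_ge0 q)).
  rewrite Im_clog; case: ifPn => [y0|].
    by rewrite sa ger0_norm.
  by rewrite -ltNge => y0; rewrite sinN sa ltr0_norm// mulNr opprK.
have : cexp (clog q) = Complex (expR (complex.Re (clog q)) * cos (complex.Im (clog q)))
  (expR (complex.Re (clog q)) * sin (complex.Im (clog q))) by case: (clog q).
rewrite Re_clog lnK ?posrE// cosI sinI ![cmod q * _]mulrC !divfK ?gt_eqF// => ->.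
by case: (q).
Qed.

(** |q| + Re q vanishes exactly on the cut of the logarithm. If a = |arg q|, then m/L <= 1 + cos a =
    1 - cos (pi - a) <= (pi - a)^2/2, which forces pi - a >= d for d = m/(L + m) <= 1. *)
Lemma box_clog (R : realType) (l L m : R) : 0 < l -> 0 < L -> 0 < m ->
  exists M d : R, [/\ 0 <= M, 0 < d < pi & forall q : CC R, q != 1 ->
    l <= cmod q <= L -> m <= cmod q + complex.Re q -> box M (pi - d) (clog q)].
Proof.
move=> l0 L0 m0; have pi2 := pi_ge2 R; pose d := m / (L + m).
have Lm : 0 < L + m by rewrite addr_gt0.
have d0 : 0 < d by rewrite divr_gt0.
have d1 : d <= 1 by rewrite ler_pdivrMr// mul1r lerDr ltW.
exists (`|ln l| + `|ln L|), d; split.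
- by rewrite addr_ge0.
- by rewrite d0/=; lra.
move=> q q1 /andP[lq qL] mq; have q0 : 0 < cmod q by exact: lt_le_trans lq.
have qn0 : q != 0 by rewrite -cmod_gt0.
split.
- apply: contraNneq q1 => w0; have := clogK qn0.
  by rewrite w0 cexp0 => <-.
- rewrite Re_clog ler_norml; apply/andP; split.
    have : ln l <= ln (cmod q) by rewrite ler_ln ?posrE.
    have := ler_norm (- ln l); rewrite normrN; have := normr_ge0 (ln L); lra.
  have : ln (cmod q) <= ln L by rewrite ler_ln ?posrE.
  have := ler_norm (ln L); have := normr_ge0 (ln l); lra.
- rewrite norm_Im_clog; set a := acos _.
  have aq : cos a = complex.Re q / cmod q.
    by rewrite acosK//; exact: Re_div_cmod_itv.
  have ap : a <= pi := acos_lepi (Re_div_cmod_itv q).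
  have := one_sub_cos_le (pi - a).
  rewrite cosB cospi sinpi mul0r addr0 mulN1r opprK aq.
  have dq : d <= 1 + complex.Re q / cmod q.
    rewrite -[1](divff (lt0r_neq0 q0)) -mulrDl ler_pdivlMr// /d mulrAC ler_pdivrMr//.
    nra.
  move: (pi : R) ap dq => p ap dq h; rewrite lerBrDr -lerBrDl; nra.
Qed.

(** |q| + Re q is 2-Lipschitz, so it keeps half of its value m on the ball of radius m/4; it is also
    at most 2 |q|, whence |q| >= m/4. *)
Lemma half_plane_ball (R : realType) (q0 : CC R) (m : R) :
  m = cmod q0 + complex.Re q0 -> forall q, cmod (q - q0) <= m / 4 ->
  m / 4 <= cmod q <= cmod q0 + m / 4 /\ m / 2 <= cmod q + complex.Re q.
Proof.
move=> mE q qm.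
have h1 : cmod q <= cmod q0 + m / 4.
  rewrite -(subrK q0 q) (le_trans (le_cmodD _ _))//; lra.
have h2 : cmod q0 - m / 4 <= cmod q.
  rewrite lerBlDr -{1}(subrK q q0) (le_trans (le_cmodD _ _))// addrC lerD2l.
  by rewrite cmodBC.
have h3 : complex.Re q0 - m / 4 <= complex.Re q.
  have := le_trans (norm_Re_le (q - q0)) qm; rewrite ler_norml raddfB/=.
  by move=> /andP[? _]; lra.
have h4 : complex.Re q <= cmod q := le_trans (ler_norm _) (norm_Re_le q).
by split; first (apply/andP; split); lra.
Qed.

Definition scaled_geo (R : realType) (P : nat -> {poly CC R}) (n : nat) (z : CC R) : CC R :=
  (P n).[z] * clog ((1 + z) / z) ^+ n.+1 / n`!%:R.

Lemma scaled_geoE (R : realType) (P : nat -> {poly CC R}) n (z : CC R) :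
  z != 0 -> 1 + z != 0 ->
  scaled_geo P n z = (1 + z)^-1 * geoG P n (clog ((1 + z) / z)).
Proof.
move=> z0 z1; rewrite /scaled_geo /geoG cexpN clogK ?mulf_neq0 ?invr_eq0//.
rewrite invf_div /geo_coef.
have e : 1 - z / (1 + z) = (1 + z)^-1.
  by field.
rewrite e invrK divfK//; move: (clog _ ^+ _) => W.
have n0 : (n`!%:R : CC R) != 0 by rewrite pnatr_eq0 -lt0n fact_gt0.
by field; rewrite n0 z1.
Qed.

(** Neighbourhoods are measured in the coordinate q = (1 + z)/z, where infinity is the ordinary
    point q = 1; one estimate then serves finite points and infinity alike. *)
Lemma scaled_geo_local (R : realType) (P : nat -> {poly CC R}) (q0 : CC R) (m e : R) :
  is_geometric_polynomials P -> m = cmod q0 + complex.Re q0 -> 0 < m -> 0 < e ->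
  exists N, forall n z, (N <= n)%N -> z != 0 -> cmod ((1 + z) / z - q0) <= m / 4 ->
    cmod (scaled_geo P n z - (1 + z)^-1) <= e.
Proof.
move=> hP mE m0 e0.
have m4 : 0 < m / 4 by lra.
have m2 : 0 < m / 2 by lra.
have L0 : 0 < cmod q0 + m / 4 by rewrite ltr_wpDl ?cmod_ge0.
have [M [d [M0 d0 hB]]] := box_clog m4 L0 m2.
(* [C] bounds 1/(1 + z) = 1 - 1/q, as |q| >= m/4. *)
pose C := 1 + (m / 4)^-1.
have C0 : 0 < C by rewrite addr_gt0 ?invr_gt0.
have [N hN] := geoG_cvg_uniform hP M0 d0 (divr_gt0 e0 C0).
exists N => n z Nn z0 qz; have [/andP[ql qL] qm] := half_plane_ball mE qz.
have qn0 : (1 + z) / z != 0 by rewrite -cmod_gt0 (lt_le_trans m4).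
have z1 : 1 + z != 0 by apply: contraNneq qn0 => ->; rewrite mul0r.
have q1 : (1 + z) / z != 1.
  by rewrite -subr_eq0; have -> : (1 + z) / z - 1 = z^-1 by [field]; rewrite invr_eq0.
have wB := hB _ q1 (introT andP (conj ql qL)) qm.
rewrite scaled_geoE//.
have -> : (1 + z)^-1 * geoG P n (clog ((1 + z) / z)) - (1 + z)^-1 =
  (1 + z)^-1 * (geoG P n (clog ((1 + z) / z)) - 1) by ring.
rewrite cmodM; have {}hN := hN n _ Nn wB.
have hz : cmod (1 + z)^-1 <= C.
  have -> : (1 + z)^-1 = 1 - ((1 + z) / z)^-1 by field; rewrite z0 z1.
  rewrite (le_trans (le_cmodD _ _))// cmod1 lerD2l cmodN cmodV lef_pV2 ?posrE//.
  exact: lt_le_trans ql.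
rewrite (le_trans (ler_pM (cmod_ge0 _) (cmod_ge0 _) hz hN))// mulrC divfK//.
by rewrite gt_eqF.
Qed.

Lemma quotient_near_infty (R : realType) (z : CC R) : 2 <= cmod z ->
  cmod ((1 + z) / z - 1) <= 2^-1.
Proof.
move=> z2; have z0 : z != 0 by rewrite -cmod_gt0; lra.
have -> : (1 + z) / z - 1 = z^-1 by field.
by rewrite cmodV lef_pV2 ?posrE//; lra.
Qed.

(** G_n is bounded near w = 0 and 1/(1 + z) decays. The constant may depend on n because the bound
    only identifies the value of each function at infinity. *)
Lemma scaled_geo_infty (R : realType) (P : nat -> {poly CC R}) n :
  is_geometric_polynomials P -> exists2 C : R, 0 <= C & forall z, 2 <= cmod z ->
    cmod (scaled_geo P n z) <= C * (cmod z - 1)^-1.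
Proof.
move=> hP.
have mE : 2 = cmod (1 : CC R) + complex.Re (1 : CC R) by rewrite cmod1.
have m4 : 0 < 2 / 4 :> R by lra.
have m2 : 0 < 2 / 2 :> R by lra.
have L0 : 0 < cmod (1 : CC R) + 2 / 4 by rewrite cmod1; lra.
have [M [d [M0 d0 hB]]] := box_clog m4 L0 m2.
have [C C0 hC] := near1_bounded M0 (near1_geoG n hP M0).
exists C => // z z2; have zc : 0 < cmod z by lra.
have z0 : z != 0 by rewrite -cmod_gt0.
have qz : cmod ((1 + z) / z - 1) <= 2 / 4.
  by rewrite (le_trans (quotient_near_infty z2))//; lra.
have [/andP[ql qL] qm] := half_plane_ball mE qz.
have z11 : cmod z - 1 <= cmod (1 + z).
  rewrite lerBlDr; have {1}-> : z = (1 + z) + - 1 by ring.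
  by rewrite (le_trans (le_cmodD _ _))// cmodN cmod1.
have z1 : 1 + z != 0 by rewrite -cmod_gt0; lra.
have q1 : (1 + z) / z != 1.
  by rewrite -subr_eq0; have -> : (1 + z) / z - 1 = z^-1 by [field]; rewrite invr_eq0.
have wB := hB _ q1 (introT andP (conj ql qL)) qm.
rewrite scaled_geoE// cmodM cmodV mulrC ler_pM ?cmod_ge0 ?invr_ge0 ?cmod_ge0//.
  by apply: hC; apply: box_sub wB; case/andP: d0 => ? ?; lra.
by rewrite lef_pV2 ?posrE//; lra.
Qed.

(** * Topology of the Riemann sphere and the covering argument *)

Lemma compact_square (R : realType) (r : R) :
  compact [set z : CC R | `|complex.Re z| <= r /\ `|complex.Im z| <= r].
Proof.
have -> : [set z : CC R | `|complex.Re z| <= r /\ `|complex.Im z| <= r] =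
    (fun p : R * R => Complex p.1 p.2 : CC R) @` (`[- r, r] `*` `[- r, r]).
  apply/seteqP; split=> [[x y]/= [xr yr]|_ [[x y]/= [xr yr] <-]]/=.
    by exists (x, y) => //=; rewrite !in_itv/= -!ler_norml.
  by move: xr yr; rewrite !in_itv/= -!ler_norml.
apply: continuous_compact; last by apply: compact_setX; exact: segment_compact.
apply: continuous_subspaceT => -[x y].
apply/cvgrPdist_le => eps eps0; have [e e0 ->] := ltc0P eps0.
have e2 : 0 < e / 2 by rewrite divr_gt0.
exists (ball x (e / 2), ball y (e / 2)); first by split; exact: nbhsx_ballx.
move=> [a b] [/= /ltW xa /ltW yb]; rewrite normCE lecR.
by rewrite (le_trans (cmod_le_ReIm _))//= (splitr e) lerD.
Qed.

Lemma CC_hausdorff (R : realType) : hausdorff_space (CC R).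
Proof. exact: (@norm_hausdorff _ (CC R)^o). Qed.

Lemma nbhs_infinity_pt (R : realType) (Q : riemann_sphere R -> Prop) (r : R) :
  Q (infinity_pt R) -> (forall z, r <= cmod z -> Q (finite_pt z)) ->
  nbhs (infinity_pt R) Q.
Proof.
move=> Qoo Qz; exists [set z : CC R | `|complex.Re z| <= r /\ `|complex.Im z| <= r].
  split; first exact: compact_square.
  by apply: compact_closed; [exact: CC_hausdorff | exact: compact_square].
move=> p [[z /= zr <-]|->//]; apply: Qz.
have [zr1|/ltW zr1] := leP `|complex.Re z| r; last exact: le_trans zr1 (norm_Re_le z).
have [zr2|/ltW zr2] := leP `|complex.Im z| r; last exact: le_trans zr2 (norm_Im_le z).
by case: zr.
Qed.

Lemma compact_cmod_bounded (R : realType) (C : set (CC R)) : compact C ->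
  exists r : R, forall z, C z -> cmod z < r.
Proof.
move=> /compact_near_coveringP/(_ nat \oo (fun n z => cmod z < n%:R) _)[|N _ hN].
  move=> z _; pose N := (Num.truncn (cmod z + 1)).+1.
  exists (ball z (1 : CC R), [set n | (N <= n)%N]).
    by split; [exact: nbhsx_ballx | exists N].
  move=> [u n] [/= zu Nn].
  have {}zu : cmod (z - u) < 1 by move: zu; rewrite /ball/= normCE ltcR.
  have uz : cmod u < cmod z + 1.
    rewrite -(subrK z u) (le_lt_trans (le_cmodD _ _))// addrC ltrD2l.
    by rewrite cmodBC.
  apply: (lt_le_trans uz); apply: (@le_trans _ _ N%:R); last by rewrite ler_nat.
  by apply/ltW; rewrite /N truncnS_gt.
by exists N%:R => z Cz; exact: (hN N (leqnn N) z Cz).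
Qed.

(** Properness makes limits at infinity unique, so that the [lim] in [sphere_ext] can be
    computed. *)
Lemma dnbhs_infinity_pt_proper (R : realType) : ProperFilter (infinity_pt R)^'.
Proof.
apply: Build_ProperFilter_ex => A [C [cC _] CA].
have [r hr] := compact_cmod_bounded cC.
pose z : CC R := (`|r|)%:C%C.
exists (finite_pt z); apply: CA => //; left; exists z => // Cz.
have := hr z Cz; rewrite cmod_real normr_id => rr.
by have := ler_norm r; rewrite leNgt rr.
Qed.

Lemma sphere_ext_infinity0 (R : realType) (f : CC R -> CC R) :
  (forall e : R, 0 < e -> exists r : R, forall z, r <= cmod z -> cmod (f z) <= e) ->
  sphere_ext f (infinity_pt R) = 0.
Proof.
move=> f0; have PF := @dnbhs_infinity_pt_proper R.
apply: (@cvg_lim (CC R) (@CC_hausdorff R) _ (infinity_pt R)^' PF (oapp f 0) 0).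
apply/cvgrPdist_le => eps eps0; have [e e0 ->] := ltc0P eps0.
have [r hr] := f0 e e0.
(* The default value 0 at infinity equals the limit, so the estimate holds on a full neighbourhood
   and then restricts to the punctured one. *)
have := @nbhs_infinity_pt R (fun p => `|0 - oapp f 0 p| <= e%:C%C) r.
move=> h; apply: nbhs_dnbhs; apply: h => /=.
  by rewrite subrr normr0 lecR ltW.
by move=> z rz; rewrite sub0r normrN normCE lecR hr.
Qed.

(** If |q| + Re q = 0 then q = -c with c = |q|, and z = 1/(q - 1) = -1/(1 + c) lies in the slit. *)
Lemma quotient_off_cut (R : realType) (z : CC R) :
  ~ real_slit R (finite_pt z) ->
  z != 0 /\ 0 < cmod ((1 + z) / z) + complex.Re ((1 + z) / z).
Proof.
move=> zS; have z0 : z != 0.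
  apply/eqP => z0; apply: zS; exists 0; last by rewrite z0.
  by rewrite /= in_itv/= lexx oppr_le0 ler01.
split=> //; set q := (1 + z) / z.
have := ler_norm (- complex.Re q); rewrite normrN => /le_trans/(_ (norm_Re_le q)) qge.
rewrite lt0r -lerBlDr sub0r qge andbT; apply/eqP => q_eq.
have Req : complex.Re q = - cmod q by lra.
have Imq : complex.Im q = 0.
  have := sqr_cmod q; rewrite Req sqrrN => /eqP.
  by rewrite addrC -subr_eq subrr eq_sym sqrf_eq0 => /eqP.
have qE : q = (- cmod q)%:C%C by rewrite -Req; move: Imq; case: (q) => x y /= ->.
have cq := cmod_ge0 q.
apply: zS; exists (- (1 + cmod q)^-1).
  rewrite /= in_itv/= oppr_le0 invr_ge0 lerN2 addr_ge0// andbT.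
  by rewrite invf_le1 ?lerDl// ltr_pwDl.
congr finite_pt.
have -> : z = (q - 1)^-1.
  by have -> : q - 1 = z^-1 by [rewrite /q; field]; rewrite invrK.
move: (cmod q) qE => c ->; rewrite rmorphN fmorphV rmorphD rmorph1 rmorphN.
by rewrite -opprD invrN addrC.
Qed.

Lemma ball_cmod (R : realType) (a b : CC R) (e : R) :
  cmod (a - b) < e -> ball a (e%:C%C) b.
Proof. by move=> ab; rewrite /ball/= normCE ltcR. Qed.

Lemma cvg_quotient (K : numFieldType) (z : K) : z != 0 ->
  (1 + u) / u @[u --> z] --> (1 + z) / z.
Proof.
move=> z0.
apply: (@cvgM K K (nbhs z) _ (fun u : K => 1 + u) (fun u : K => u^-1) (1 + z) z^-1).
  apply: (@cvgD K K^o K (nbhs z) _ (fun _ : K => 1) (fun u : K => u) 1 z).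
    exact: cvg_cst.
  exact: cvg_id.
by apply: (@cvgV K K (nbhs z) _ (fun u : K => u) z) => //; exact: cvg_id.
Qed.

Lemma quotient_near (R : realType) (z : CC R) (e : R) : z != 0 -> 0 < e ->
  \forall u \near z, u != 0 /\ cmod ((1 + u) / u - (1 + z) / z) <= e.
Proof.
move=> z0 e0; have e0' : (0 : CC R) < e%:C%C by rewrite ltcR.
have nz : \forall u \near z, u != 0.
  by apply: (@cvgr_neq0 (CC R) (CC R)^o _ (nbhs z) _ id z) => //; exact: cvg_id.
move/cvgrPdist_le/(_ _ e0'): (cvg_quotient z0); apply: filterS2 nz => u u0.
by rewrite normCE lecR cmodBC.
Qed.

Theorem theorem3 (R : realType) (P : nat -> {poly CC R})
    (hP : is_geometric_polynomials P)
    (K : set (riemann_sphere R)) (cK : compact K) (hK : K `<=` ~` real_slit R) :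
  {uniform K,
    (fun n : nat => sphere_ext (fun z : CC R =>
       (P n).[z] * clog ((1 + z) / z) ^+ n.+1 / n`!%:R)) @ \oo
    --> sphere_ext (fun z : CC R => (1 + z)^-1)}.
Proof.
have ext_inv0 : sphere_ext (fun z : CC R => (1 + z)^-1) (infinity_pt R) = 0.
  apply: sphere_ext_infinity0 => e e0; exists (e^-1 + 1) => z ez.
  have ei : 0 < e^-1 by rewrite invr_gt0.
  have : cmod z <= cmod (1 + z) + 1.
    have {1}-> : z = (1 + z) + - 1 by ring.
    by rewrite (le_trans (le_cmodD _ _))// cmodN cmod1.
  move=> h; have h1 : e^-1 <= cmod (1 + z) by lra.
  by rewrite cmodV -(invrK e) lef_pV2 ?posrE// (lt_le_trans ei).
have ext_geo0 n : sphere_ext (scaled_geo P n) (infinity_pt R) = 0.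
  apply: sphere_ext_infinity0 => e e0; have [C C0 hC] := scaled_geo_infty n hP.
  exists (C / e + 2) => z ze; have Ce : 0 <= C / e by rewrite divr_ge0// ltW.
  rewrite (le_trans (hC z _))//; first by lra.
  by rewrite ler_pdivrMr; [rewrite mulrC -ler_pdivrMr//; lra | lra].
move=> U /uniform_nbhs[E [entE EU]].
have [eps /= eps0 epsE] : exists2 eps : CC R, 0 < eps &
    [set xy | ball xy.1 eps xy.2] `<=` E.
  by move: entE; rewrite -entourage_ballE.
have [e e0 epsE'] := ltc0P eps0; rewrite {}epsE' {eps eps0} in epsE.
have e2 : 0 < e / 2 by lra.
pose F n := sphere_ext (scaled_geo P n).
pose f := sphere_ext (fun z : CC R => (1 + z)^-1).
suff : \forall n \near \oo, K `<=` (fun p => cmod (F n p - f p) <= e / 2).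
  move=> [N _ hN]; exists N => // n Nn; apply: EU => p Kp; apply: epsE.
  by apply: ball_cmod; rewrite cmodBC (le_lt_trans (hN n Nn p Kp))//; lra.
(* Compactness as a covering property: it suffices to find, around each point of [K], a
   neighbourhood and a tail of indices on which the estimate holds. *)
have /compact_near_coveringP := cK; apply => -[z|] Kp; last first.
  (* At infinity q0 = 1 and m = 2, so |z| >= 2 gives |q - 1| = 1/|z| <= m/4. *)
  have mE : 2 = cmod (1 : CC R) + complex.Re (1 : CC R) by rewrite cmod1.
  have [N hN] := scaled_geo_local hP mE (ltr0n _ 2) e2.
  exists ([set p : riemann_sphere R | forall n, (N <= n)%N -> cmod (F n p - f p) <= e / 2],
    [set n | (N <= n)%N]).
    split; last by exists N.
    apply: (@nbhs_infinity_pt _ _ 2) => [n _|z z2 n Nn].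
      by rewrite /F /f ext_geo0 ext_inv0 subrr cmod0 ltW.
    apply: hN => //; first by rewrite -cmod_gt0 (lt_le_trans _ z2).
    by rewrite (le_trans (quotient_near_infty z2))//; lra.
  by move=> [p n] [/= pP Nn]; exact: pP.
have [z0 m0] := quotient_off_cut (hK _ Kp).
have [N hN] := scaled_geo_local hP (erefl _) m0 e2.
set m := (cmod _ + _) in m0 hN.
have m4 : 0 < m / 4 by lra.
have near_z := quotient_near z0 m4.
exists ([set p : riemann_sphere R | forall n, (N <= n)%N -> cmod (F n p - f p) <= e / 2],
  [set n | (N <= n)%N]).
  split; last by exists N.
  (* Neighbourhoods of a finite point of the compactification unfold to neighbourhoods of [z] in the
     plane. *)
  have : \forall u \near z, forall n, (N <= n)%N ->
      cmod (F n (finite_pt u) - f (finite_pt u)) <= e / 2.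
    by apply: filterS near_z => u [u0 uz] n Nn; exact: hN.
  by [].
by move=> [p n] [/= pP Nn]; exact: pP.
Qed.
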